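(* Let $n\geq 4$ and let $\mathcal{C}\subset S^2_B\Lambda^2\mathbb{R}^n$ be a closed, convex, $O(n)$-invariant, Ricci flow invariant curvature cone which contains the identity operator $\mathrm{I}:\Lambda^2\mathbb{R}^n\to\Lambda^2\mathbb{R}^n$ in its interior. If $\mathcal{C}\setminus\{0\}$ contains a Ricci flat curvature operator (that is, a nonzero $\mathrm{R}\in\mathcal{C}$ with $\rho(\mathrm{R})=0$), then $\mathcal{C}$ is either the whole space $S^2_B\Lambda^2\mathbb{R}^n$ or the cone $\mathcal{C}_{\mathrm{Scal}}=\{\mathrm{R}\in S^2_B\Lambda^2\mathbb{R}^n : \mathrm{trace}(\mathrm{R})\geq 0\}$.
   Context: $\mathbb{R}^n$ has its standard Euclidean structure and $\Lambda^2\mathbb{R}^n$ the inner product $\langle x\wedge y,z\wedge t\rangle=\langle x,z\rangle\langle y,t\rangle-\langle x,t\rangle\langle y,z\rangle$. $S^2_B\Lambda^2\mathbb{R}^n$ is the space of algebraic curvature operators: symmetric endomorphisms $\mathrm{R}$ of $\Lambda^2\mathbb{R}^n$ satisfying the first Bianchi identity $\langle \mathrm{R}(x\wedge y),z\wedge t\rangle+\langle \mathrm{R}(z\wedge x),y\wedge t\rangle+\langle \mathrm{R}(y\wedge z),x\wedge t\rangle=0$ for all $x,y,z,t\in\mathbb{R}^n$. The group $O(n)$ acts by $\langle (g.\mathrm{R})(x\wedge y),z\wedge t\rangle=\langle \mathrm{R}(gx\wedge gy),gz\wedge gt\rangle$. The Ricci tensor of $\mathrm{R}$ is the symmetric operator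 $\rho(\mathrm{R})$ on $\mathbb{R}^n$ with $\langle\rho(\mathrm{R})x,y\rangle=\sum_{i=1}^n\langle \mathrm{R}(x\wedge e_i),y\wedge e_i\rangle$ for an orthonormal basis $(e_i)$; the scalar curvature is twice the trace of $\mathrm{R}$. A curvature cone is a closed convex cone $\mathcal{C}\subset S^2_B\Lambda^2\mathbb{R}^n$ which is $O(n)$-invariant and contains the identity operator $\mathrm{I}$ of $\Lambda^2\mathbb{R}^n$ in its interior. Define the quadratic vector field $Q(\mathrm{R})=\mathrm{R}^2+\mathrm{R}^\#$ on $S^2_B\Lambda^2\mathbb{R}^n$, where $\mathrm{R}^2$ is the square as an endomorphism and $\mathrm{R}^\#$ is the symmetric operator with $\langle \mathrm{R}^\#\eta,\eta\rangle=-\frac12\sum_i\langle[\eta,\mathrm{R}([\eta,\mathrm{R}(\omega_i)])],\omega_i\rangle$, $(\omega_i)$ being an orthonormal basis of $\Lambda^2\mathbb{R}^n$ and the Lie bracket coming from the identification $\Lambda^2\mathbb{R}^n\simeq\mathfrak{so}(n,\mathbb{R})$, $x\wedge y\mapsto(u\mapsto\langle x,u\rangle y-\langle y,u\rangle x)$. A curvature cone $\mathcal{C}$ is Ricci flow invariant if $Q(\mathrm{R})\in T_{\mathrm{R}}\mathcal{C}$ for every $\mathrm{R}\in\partial\mathcal{C}$, where the tangent cone $T_{\mathrm{R}}\mathcal{C}$ is the closure of $\{\mathrm{L} : \exists t>0,\ \mathrm{R}+t\mathrm{L}\in\mathcal{C}\}$. Equivalently, solutions of $\frac{d}{dt}\mathrm{R}=Q(\mathrm{R})$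 starting in $\mathcal{C}$ stay in $\mathcal{C}$ for positive times. *)

(* Defs.v *)
From HB Require Import structures.
From mathcomp Require Import all_boot all_order all_algebra.
From mathcomp Require Import all_classical all_reals all_analysis.
From mathcomp Require Import ring lra.
Set Implicit Arguments.
Unset Strict Implicit.
Unset Printing Implicit Defensive.
Import Order.TTheory GRing.Theory Num.Theory.
Import numFieldNormedType.Exports.
Local Open Scope classical_set_scope.
Local Open Scope ring_scope.

(* Vectors of R^n are columns 'cV[R]_n.  A bivector is the column of its
   coordinates in the basis e_i /\ e_j, i < j; this basis is orthonormal for
   the inner product on Lambda^2 R^n (see [dot_wedge]), which is therefore the
   standard dot product of the coordinates.  Endomorphisms of Lambda^2 R^n are
   matrices in this basis, with the topology of 'M[R]_(dimL2 n). *)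

Notation opair n := {p : 'I_n * 'I_n | (p.1 < p.2)%N}.

Definition dimL2 (n : nat) : nat := #|{: opair n}|.

Definition lo (n : nat) (k : 'I_(dimL2 n)) : 'I_n :=
  (val (enum_val k : opair n)).1.
Definition hi (n : nat) (k : 'I_(dimL2 n)) : 'I_n :=
  (val (enum_val k : opair n)).2.

Section Operators.
Variable R : realType.

Definition dot (m : nat) (x y : 'cV[R]_m) : R := \sum_i x i 0 * y i 0.

Definition basisv (m : nat) (i : 'I_m) : 'cV[R]_m := delta_mx i 0.

Variable n : nat.
Implicit Types (x y z t u : 'cV[R]_n) (g : 'M[R]_n).
Implicit Types (eta zeta v : 'cV[R]_(dimL2 n)) (A B : 'M[R]_(dimL2 n)).

Definition wedge x y : 'cV[R]_(dimL2 n) :=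
  \col_k (x (lo k) 0 * y (hi k) 0 - x (hi k) 0 * y (lo k) 0).

(* The identification of Lambda^2 R^n with so(n) mapping x /\ y to
   u |-> <x,u> y - <y,u> x (see [so_of_wedge]), and its inverse. *)
Definition so_of eta : 'M[R]_n :=
  \sum_k eta k 0 *: (delta_mx (hi k) (lo k) - delta_mx (lo k) (hi k)).
Definition of_so g : 'cV[R]_(dimL2 n) := \col_k g (hi k) (lo k).

Definition lie eta zeta : 'cV[R]_(dimL2 n) :=
  of_so (so_of eta *m so_of zeta - so_of zeta *m so_of eta).

Definition bianchi A : Prop := forall x y z t,
  dot (A *m wedge x y) (wedge z t) + dot (A *m wedge z x) (wedge y t)
    + dot (A *m wedge y z) (wedge x t) = 0.

Definition curvop : set 'M[R]_(dimL2 n) := [set A | A^T = A /\ bianchi A].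

(* Lambda^2 g, the map x /\ y |-> gx /\ gy (see [ext2_wedge]). *)
Definition ext2 g : 'M[R]_(dimL2 n) :=
  \matrix_(k, l) wedge (col (lo l) g) (col (hi l) g) k 0.

Definition orthogonal_mx g : Prop := g^T *m g = 1%:M.

Definition act g A : 'M[R]_(dimL2 n) := (ext2 g)^T *m A *m ext2 g.

Definition ricci A : 'M[R]_n :=
  \matrix_(a, b)
    \sum_i dot (A *m wedge (basisv b) (basisv i)) (wedge (basisv a) (basisv i)).

(* The bilinear form whose diagonal is the quadratic form defining A^#; it is
   symmetric (see [sharp_sym] and [sharp_quad]). *)
Definition sharp_form A eta zeta : R :=
  - 2^-1 * \sum_k dot (lie eta (A *m lie zeta (A *m basisv k))) (basisv k).

Definition sharp A : 'M[R]_(dimL2 n) :=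
  \matrix_(k, l) sharp_form A (basisv k) (basisv l).

Definition Qfield A : 'M[R]_(dimL2 n) := A *m A + sharp A.

(* Interior and boundary are relative to the space of curvature operators,
   which is a proper linear subspace of the ambient matrix space. *)
Definition curv_interior (C : set 'M[R]_(dimL2 n)) : set 'M[R]_(dimL2 n) :=
  curvop `&` interior (C : set (subspace curvop)).
Definition curv_boundary (C : set 'M[R]_(dimL2 n)) : set 'M[R]_(dimL2 n) :=
  closure C `\` curv_interior C.

Record curvature_cone (C : set 'M[R]_(dimL2 n)) : Prop := CurvatureCone {
  cone_sub : C `<=` curvop;
  cone_closed : closed C;
  cone_convex : convex_set (C : set (convex_lmodType 'M[R]_(dimL2 n)));
  cone_scale : forall (a : R) A, 0 <= a -> C A -> C (a *: A);
  cone_act : forall g A, orthogonal_mx g -> C A -> C (act g A);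
  cone_id : curv_interior C 1%:M
}.

Definition tangent_cone (C : set 'M[R]_(dimL2 n)) A : set 'M[R]_(dimL2 n) :=
  closure [set L | exists2 s : R, 0 < s & C (A + s *: L)].

Definition ricci_flow_invariant (C : set 'M[R]_(dimL2 n)) : Prop :=
  forall A, curv_boundary C A -> tangent_cone C A (Qfield A).

Definition cone_scal : set 'M[R]_(dimL2 n) :=
  [set A | curvop A /\ 0 <= \tr A].

Lemma curv_interiorE (C : set 'M[R]_(dimL2 n)) A :
  curv_interior C A <-> curvop A /\ exists2 e : R, 0 < e &
    forall B, curvop B -> `|A - B| < e -> C B.
Proof.
split => [[SA]|[SA [e e0 H]]].
  rewrite /interior /= => h; split=> //; move: h.
  case: (nbhs_subspaceP (@curvop)) => // _.
  move=> /nbhs_ballP[e e0 H]; exists e => // B SB AB.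
  by apply: H => //; rewrite -ball_normE.
split=> //; rewrite /interior /=.
case: (nbhs_subspaceP (@curvop)) => // _.
apply/nbhs_ballP; exists e => // B; rewrite -ball_normE /= => AB SB.
exact: H.
Qed.

Lemma sum_opair (G : 'I_n -> 'I_n -> R) :
  (forall i j, G i j = G j i) -> (forall i, G i i = 0) ->
  \sum_(k < dimL2 n) G (lo k) (hi k) = 2^-1 * \sum_i \sum_j G i j.
Proof.
move=> Gsym G0.
have -> : \sum_(k < dimL2 n) G (lo k) (hi k)
    = \sum_(i : 'I_n) \sum_(j : 'I_n | (i < j)%N) G i j.
  rewrite pair_big_dep /=.
  transitivity (\sum_(q : opair n) G (val q).1 (val q).2).
    rewrite [RHS](big_enum_val (fun q : opair n => G (val q).1 (val q).2)) /=.
    by apply: eq_bigr.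
  rewrite (reindex_omap (val : opair n -> _) insub) /=; last first.
    by move=> p Pp; rewrite insubT.
  by apply: eq_bigl => q; rewrite valK eqxx (valP q).
have H : \sum_i \sum_j G i j
  = \sum_(i : 'I_n) \sum_(j : 'I_n | (i < j)%N) G i j
    + \sum_(i : 'I_n) \sum_(j : 'I_n | (j < i)%N) G i j.
  rewrite -big_split /=; apply: eq_bigr => i _.
  rewrite (bigID (fun j : 'I_n => (i < j)%N)) /=; congr (_ + _).
  rewrite (bigD1 i) ?ltnn //= G0 add0r; apply: eq_bigl => j.
  by rewrite -leqNgt [in RHS]ltn_neqAle andbC.
have H' : \sum_(i : 'I_n) \sum_(j : 'I_n | (j < i)%N) G i j
  = \sum_(i : 'I_n) \sum_(j : 'I_n | (i < j)%N) G i j.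
  rewrite (exchange_big_dep predT) //=.
  by apply: eq_bigr => i _; apply: eq_bigr => j _; rewrite Gsym.
by rewrite H H'; field.
Qed.

Lemma dot_wedge x y z t :
  dot (wedge x y) (wedge z t) = dot x z * dot y t - dot x t * dot y z.
Proof.
pose G i j := (x i 0 * y j 0 - x j 0 * y i 0) * (z i 0 * t j 0 - z j 0 * t i 0).
have -> : dot (wedge x y) (wedge z t) = \sum_(k < dimL2 n) G (lo k) (hi k).
  by apply: eq_bigr => k _; rewrite !mxE.
rewrite sum_opair; [|by rewrite /G => *; ring|by rewrite /G => *; ring].
rewrite /dot.
have -> : \sum_i \sum_j G i j
  = (\sum_i \sum_j x i 0 * z i 0 * (y j 0 * t j 0)
    - \sum_i \sum_j x i 0 * t i 0 * (y j 0 * z j 0))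
    + (\sum_i \sum_j y i 0 * t i 0 * (x j 0 * z j 0)
    - \sum_i \sum_j y i 0 * z i 0 * (x j 0 * t j 0)).
  rewrite -!sumrB -big_split; apply: eq_bigr => i _ /=.
  rewrite -!sumrB -big_split; apply: eq_bigr => j _ /=.
  by rewrite /G; ring.
by rewrite -!big_distrlr /=; field.
Qed.

Lemma basisvE (m : nat) (i j : 'I_m) : basisv i j 0 = (j == i)%:R.
Proof. by rewrite mxE eqxx andbT. Qed.

Lemma dot_basisv (m : nat) (v : 'cV[R]_m) i : dot v (basisv i) = v i 0.
Proof.
rewrite /dot (bigD1 i) //= basisvE eqxx mulr1 big1 ?addr0 // => j ji.
by rewrite basisvE (negbTE ji) mulr0.
Qed.

Lemma dotE (m : nat) (v w : 'cV[R]_m) : dot v w = (v^T *m w) 0 0.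
Proof. by rewrite mxE; apply: eq_bigr => i _; rewrite mxE. Qed.

Lemma so_ofE eta i j :
  so_of eta i j = \sum_k eta k 0 *
    (((i == hi k) && (j == lo k))%:R - ((i == lo k) && (j == hi k))%:R).
Proof. by rewrite summxE; apply: eq_bigr => k _; rewrite !mxE. Qed.

Lemma lo_hi_inj (k l : 'I_(dimL2 n)) : lo k = lo l -> hi k = hi l -> k = l.
Proof.
rewrite /lo /hi => e1 e2; apply: enum_val_inj; apply: val_inj.
by move: e1 e2; case: (val _) => ? ?; case: (val _) => ? ? /= -> ->.
Qed.

Lemma lo_lt_hi (k : 'I_(dimL2 n)) : (lo k < hi k)%N.
Proof. exact: (valP (enum_val k : opair n)). Qed.

Lemma so_ofK : cancel so_of of_so.
Proof.
move=> eta; apply/colP => k; rewrite mxE so_ofE (bigD1 k) //= !eqxx /=.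
have /negbTE-> : hi k != lo k by rewrite -val_eqE gtn_eqF // lo_lt_hi.
rewrite subr0 mulr1 big1 ?addr0 // => l lk.
have -> : (hi k == hi l) && (lo k == lo l) = false.
  apply/negP => /andP[/eqP e1 /eqP e2]; move/eqP: lk; apply.
  by apply: lo_hi_inj.
have -> : (hi k == lo l) && (lo k == hi l) = false.
  apply/negP => /andP[/eqP e1 /eqP e2]; move: (lo_lt_hi l) (lo_lt_hi k).
  by rewrite -e1 -e2 => /ltn_trans h /h; rewrite ltnn.
by rewrite subrr mulr0.
Qed.

Lemma so_of_wedge x y u :
  so_of (wedge x y) *m u = dot x u *: y - dot y u *: x.
Proof.
have -> : so_of (wedge x y) = y *m x^T - x *m y^T.
  apply/matrixP => a b; rewrite so_ofE.
  pose G i j := (x i 0 * y j 0 - x j 0 * y i 0) *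
    (((a == j) && (b == i))%:R - ((a == i) && (b == j))%:R).
  have -> : \sum_k wedge x y k 0 *
      (((a == hi k) && (b == lo k))%:R - ((a == lo k) && (b == hi k))%:R)
    = \sum_(k < dimL2 n) G (lo k) (hi k).
    by apply: eq_bigr => k _; rewrite !mxE.
  rewrite sum_opair; last 2 first.
  - by rewrite /G => *; ring.
  - by rewrite /G => *; ring.
  have D (H : 'I_n -> 'I_n -> R) a' b' :
      \sum_i \sum_j H i j * ((a' == i) && (b' == j))%:R = H a' b'.
    rewrite (bigD1 a') //= [X in _ + X]big1 ?addr0; last first.
      move=> i ia; rewrite big1 // => j _.
      by rewrite eq_sym (negbTE ia) /= mulr0.
    rewrite (bigD1 b') //= !eqxx mulr1 big1 ?addr0 // => j jb.
    by rewrite [b' == j]eq_sym (negbTE jb) /= mulr0.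
  have -> : \sum_i \sum_j G i j
    = \sum_i \sum_j (x i 0 * y j 0 - x j 0 * y i 0) * ((b == i) && (a == j))%:R
    - \sum_i \sum_j (x i 0 * y j 0 - x j 0 * y i 0) * ((a == i) && (b == j))%:R.
    rewrite -sumrB; apply: eq_bigr => i _; rewrite -sumrB; apply: eq_bigr => j _.
    by rewrite /G mulrBr [(a == j) && _]andbC.
  rewrite (D (fun i j => x i 0 * y j 0 - x j 0 * y i 0)).
  rewrite (D (fun i j => x i 0 * y j 0 - x j 0 * y i 0)).
  by rewrite !mxE !big_ord1 !mxE; field.
rewrite mulmxBl -!mulmxA; congr (_ - _); apply/colP => i;
  by rewrite !mxE big_ord1 dotE mulrC.
Qed.

Lemma of_soK g : g^T = - g -> so_of (of_so g) = g.
Proof.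
move=> gA; apply/matrixP => a b; rewrite so_ofE.
have gE i j : g j i = - g i j by move/matrixP: gA => /(_ i j); rewrite !mxE.
have g0 i : g i i = 0 by have := gE i i; lra.
pose G i j := g j i * (((a == j) && (b == i))%:R - ((a == i) && (b == j))%:R).
have -> : \sum_k of_so g k 0 *
      (((a == hi k) && (b == lo k))%:R - ((a == lo k) && (b == hi k))%:R)
    = \sum_(k < dimL2 n) G (lo k) (hi k).
  by apply: eq_bigr => k _; rewrite !mxE.
rewrite sum_opair; last 2 first.
- by move=> i j; rewrite /G (gE i j); ring.
- by move=> i; rewrite /G g0 mul0r.
have D (H : 'I_n -> 'I_n -> R) a' b' :
    \sum_i \sum_j H i j * ((a' == i) && (b' == j))%:R = H a' b'.
  rewrite (bigD1 a') //= [X in _ + X]big1 ?addr0; last first.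
    move=> i ia; rewrite big1 // => j _.
    by rewrite eq_sym (negbTE ia) /= mulr0.
  rewrite (bigD1 b') //= !eqxx mulr1 big1 ?addr0 // => j jb.
  by rewrite [b' == j]eq_sym (negbTE jb) /= mulr0.
have -> : \sum_i \sum_j G i j
    = \sum_i \sum_j g j i * ((b == i) && (a == j))%:R
    - \sum_i \sum_j g j i * ((a == i) && (b == j))%:R.
  rewrite -sumrB; apply: eq_bigr => i _; rewrite -sumrB; apply: eq_bigr => j _.
  by rewrite /G mulrBr [(a == j) && _]andbC.
by rewrite (D (fun i j => g j i)) (D (fun i j => g j i)) (gE a b); field.
Qed.

Lemma so_of_lie eta zeta :
  so_of (lie eta zeta) = so_of eta *m so_of zeta - so_of zeta *m so_of eta.
Proof.
have soT v : (so_of v)^T = - so_of v.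
  apply/matrixP => i j; rewrite [LHS]mxE [RHS]mxE !so_ofE -sumrN.
  apply: eq_bigr => k _; rewrite -mulrN opprB.
  by rewrite andbC [in X in _ - X]andbC.
rewrite /lie of_soK // linearB /= !trmx_mul !soT !mulNmx !mulmxN !opprK.
by rewrite opprB.
Qed.

Lemma ext2_wedge g x y : ext2 g *m wedge x y = wedge (g *m x) (g *m y).
Proof.
apply/colP => k; rewrite !mxE.
pose G i j := (g (lo k) i * g (hi k) j - g (hi k) i * g (lo k) j) *
   (x i 0 * y j 0 - x j 0 * y i 0).
have -> : \sum_l ext2 g k l * wedge x y l 0 = \sum_(l < dimL2 n) G (lo l) (hi l).
  by apply: eq_bigr => l _; rewrite !mxE.
rewrite sum_opair; [|by rewrite /G => *; ring|by rewrite /G => *; ring].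
have -> : \sum_i \sum_j G i j
  = (\sum_i \sum_j g (lo k) i * x i 0 * (g (hi k) j * y j 0)
    - \sum_i \sum_j g (lo k) i * y i 0 * (g (hi k) j * x j 0))
    + (\sum_i \sum_j g (hi k) i * y i 0 * (g (lo k) j * x j 0)
    - \sum_i \sum_j g (hi k) i * x i 0 * (g (lo k) j * y j 0)).
  rewrite -!sumrB -big_split; apply: eq_bigr => i _ /=.
  rewrite -!sumrB -big_split; apply: eq_bigr => j _ /=.
  by rewrite /G; ring.
by rewrite -!big_distrlr /=; field.
Qed.

Lemma act_wedge g A x y z t :
  dot (act g A *m wedge x y) (wedge z t)
  = dot (A *m wedge (g *m x) (g *m y)) (wedge (g *m z) (g *m t)).
Proof.
rewrite -!ext2_wedge !dotE; congr (fun_of_matrix _ 0 0).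
by rewrite /act !trmx_mul trmxK !mulmxA.
Qed.

Lemma ricciE A x y :
  dot (ricci A *m x) y
  = \sum_i dot (A *m wedge x (basisv i)) (wedge y (basisv i)).
Proof.
pose W i : 'M[R]_(dimL2 n, n) := \matrix_(k, a) wedge (basisv a) (basisv i) k 0.
have WE i u : wedge u (basisv i) = W i *m u.
  apply/colP => k; rewrite !mxE.
  have D a (f : 'I_n -> R) : \sum_b (a == b)%:R * f b = f a.
    rewrite (bigD1 a) //= eqxx mul1r big1 ?addr0 // => b.
    by rewrite eq_sym => /negbTE ->; rewrite mul0r.
  rewrite !eqxx !andbT.
  under eq_bigr => a _ do rewrite !mxE !eqxx !andbT mulrBl -!mulrA.
  by rewrite sumrB !D; ring.
have -> : ricci A = \sum_i (W i)^T *m A *m W i.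
  apply/matrixP => a b; rewrite mxE summxE; apply: eq_bigr => i _.
  have cW c : wedge (basisv c) (basisv i) = col c (W i).
    by apply/colP => k; rewrite !mxE.
  rewrite !cW /dot -mulmxA mxE; apply: eq_bigr => k _.
  rewrite mulrC; congr (_ * _); first by rewrite !mxE.
  by rewrite !mxE; apply: eq_bigr => l _; rewrite !mxE.
rewrite mulmx_suml.
transitivity (\sum_i dot (((W i)^T *m A *m W i) *m x) y).
  rewrite /dot [RHS]exchange_big /=; apply: eq_bigr => a _.
  by rewrite summxE mulr_suml; apply: eq_bigr.
apply: eq_bigr => i _; rewrite !WE !dotE; congr (fun_of_matrix _ 0 0).
by rewrite !trmx_mul trmxK !mulmxA.
Qed.

Lemma lie_linear eta : linear (lie eta).
Proof.
have soL (a : R) v w : so_of (a *: v + w) = a *: so_of v + so_of w.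
  rewrite /so_of scaler_sumr -big_split /=; apply: eq_bigr => k _.
  by rewrite !mxE scalerDl scalerA.
move=> a v w; rewrite /lie soL mulmxDr mulmxDl -scalemxAl -scalemxAr.
by apply/colP => k; rewrite !mxE; ring.
Qed.

Definition ad eta : 'M[R]_(dimL2 n) := \matrix_(k, l) lie eta (basisv l) k 0.

Lemma adE eta v : ad eta *m v = lie eta v.
Proof.
have H0 : lie eta 0 = 0.
  by have := lie_linear eta (-1) 0 0; rewrite scaler0 addr0 scaleN1r addNr.
have HD (a : R) (u w : 'cV[R]_(dimL2 n)) : lie eta (a *: u + w) = a *: lie eta u + lie eta w.
  exact: lie_linear.
have vE : v = \sum_l v l 0 *: basisv l.
  apply/colP => k; rewrite summxE (bigD1 k) //= big1 ?addr0.
    by rewrite mxE basisvE eqxx mulr1.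
  by move=> l lk; rewrite mxE basisvE eq_sym (negbTE lk) mulr0.
rewrite [in RHS]vE.
have -> : lie eta (\sum_l v l 0 *: basisv l) = \sum_l v l 0 *: lie eta (basisv l).
  by elim/big_rec2: _ => [//|l u w _ <-]; rewrite HD.
apply/colP => k; rewrite summxE mxE; apply: eq_bigr => l _.
by rewrite !mxE mulrC.
Qed.

Lemma sharp_formE A eta zeta :
  sharp_form A eta zeta = - 2^-1 * \tr (ad eta *m A *m ad zeta *m A).
Proof.
rewrite /sharp_form; congr (_ * _); apply: eq_bigr => k _.
by rewrite dot_basisv -!adE !mulmxA /basisv -colE mxE.
Qed.

Lemma sharp_formC A eta zeta : sharp_form A eta zeta = sharp_form A zeta eta.
Proof.
by rewrite !sharp_formE; congr (_ * _); rewrite -mulmxA mxtrace_mulC !mulmxA.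
Qed.

Lemma sharp_sym A : (sharp A)^T = sharp A.
Proof. by apply/matrixP => k l; rewrite !mxE sharp_formC. Qed.

Lemma sharp_quad A eta : dot (sharp A *m eta) eta
  = - 2^-1 * \sum_k dot (lie eta (A *m lie eta (A *m basisv k))) (basisv k).
Proof.
rewrite -/(sharp_form A eta eta).
have lieN (u v : 'cV[R]_(dimL2 n)) : lie u v = - lie v u.
  by rewrite /lie -[in RHS]opprB; apply/colP => k; rewrite !mxE opprK.
have adD (a : R) (u v : 'cV[R]_(dimL2 n)) : ad (a *: u + v) = a *: ad u + ad v.
  have H w : lie (a *: u + v) w = a *: lie u w + lie v w.
    by rewrite lieN (lie_linear w) opprD -scalerN -!lieN.
  by apply/matrixP => k l; rewrite mxE H !mxE.
have ad0 : ad 0 = 0.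
  by have := adD (-1) 0 0; rewrite scaler0 addr0 scaleN1r addNr.
have adS : ad eta = \sum_l eta l 0 *: ad (basisv l).
  have vE : eta = \sum_l eta l 0 *: basisv l.
    apply/colP => k; rewrite summxE (bigD1 k) //= big1 ?addr0.
      by rewrite mxE basisvE eqxx mulr1.
    by move=> l lk; rewrite mxE basisvE eq_sym (negbTE lk) mulr0.
  rewrite [in LHS]vE.
  by elim/big_rec2: _ => [//|l u w _ <-]; rewrite adD.
rewrite sharp_formE {1}adS !mulmx_suml raddf_sum mulr_sumr /dot.
apply: eq_bigr => k _; rewrite mxE mulr_suml.
rewrite adS mulmx_sumr mulmx_suml raddf_sum mulr_sumr.
apply: eq_bigr => l _; rewrite mxE sharp_formE.
by rewrite /= -!scalemxAl -!scalemxAr -!scalemxAl !mxtraceZ; ring.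
Qed.

End Operators.

(* Main.v *)
Require Import Defs.
From mathcomp Require Import all_boot all_order all_algebra.
From mathcomp Require Import fingroup perm.
From mathcomp Require Import all_classical all_reals all_analysis.
From mathcomp Require Import ring lra.
Set Implicit Arguments.
Unset Strict Implicit.
Unset Printing Implicit Defensive.
Import Order.TTheory GRing.Theory Num.Theory.
Import numFieldNormedType.Exports.
Local Open Scope classical_set_scope.
Local Open Scope ring_scope.

(** If [C] contains a nonzero Ricci-flat [F], every element [B] of the dual cone
    is nonnegative on the orbit of [F]; the signed permutations average this
    orbit to 0, so [B] is orthogonal to it, and since the Ricci-flat operators
    form an irreducible O(n)-module, [B] has no Weyl part.  Hence [C] is the
    inverse image under the Ricci contraction of the dual of a cone [D] of
    symmetric matrices.

    Put [(L_W phi)_ab = sum_jl W_ajbl phi_jl].  Then [Ric (Q A) = L_A (Ric A)],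
    and if [phi] in [D] supports [C] at [A], so does it at [A + s W] for every
    real [s] and every Ricci-flat [W]; invariance then gives
    [<phi, L_W (Ric A)> = 0].  Let [a] maximise the norm on the compact slice
    [D1] of [D] of trace 1.  Comparing [|(1 + c L_W) a|^2] with the maximum of
    [|(1 + c L_W) phi|^2] over [D1] for a small [c > 0], where the orthogonality
    relation controls the terms of order one, forces [L_W a = 0] for all [W].
    So [a] is scalar and [D1 = {a}], unless [D] is 0. *)

(** * Components and the Ricci tensor of the quadratic field *)

(** The relation between a support form and a boundary point is useful only once such pairs are
    produced. A maximiser p on D1 of the convex form |T phi|^2, with T self-adjoint, also maximises
    the linear form <T^2 p, phi>; if k is its maximum, k 1 - T^2 p lies in the dual of D and is
    orthogonal to p, so its lift to a curvature operator is a point of C supported by p. For T = 1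
    this yields only the scalar equation <a, L_W a> = 0, which does not force L_W a = 0. For T = 1 +
    c L_W it trades the term 2c <p, L_W p> of |T p|^2 for -4 c^2 |L_W p|^2 up to order c^3, so that
    |T p| <= |p|, whereas |T a|^2 = |a|^2 + c^2 |L_W a|^2. No integration over O(n) is involved:
    sign changes reduce an operator to the curvatures of the coordinate planes, on which
    permutations act by relabelling. Irreducibility rests on one model operator, with alternating
    weights on a 4-cycle of coordinate planes, that can be extracted from every nonzero Ricci-flat
    operator. *)

Section Bivectors.
Variable R : realType.

Lemma dotC m (u v : 'cV[R]_m) : dot u v = dot v u.
Proof. by apply: eq_bigr => i _; rewrite mulrC. Qed.

Lemma dot_linear m (w : 'cV[R]_m) a u v :
  dot (a *: u + v) w = a * dot u w + dot v w.
Proof.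
by rewrite /dot mulr_sumr -big_split; apply: eq_bigr => i _ /=; rewrite !mxE; ring.
Qed.

Lemma dot_linearr m (w : 'cV[R]_m) a u v :
  dot w (a *: u + v) = a * dot w u + dot w v.
Proof. by rewrite dotC dot_linear ![dot _ w]dotC. Qed.

Lemma linear_scale (V : lmodType R) (f : V -> R) c x :
  (forall a u v, f (a *: u + v) = a * f u + f v) -> f (c *: x) = c * f x.
Proof.
move=> fL; have := fL c x 0; have := fL (-1) 0 0.
by rewrite scaler0 !addr0; lra.
Qed.

Lemma linear_basisv m (f : 'cV[R]_m -> R) x :
  (forall a u v, f (a *: u + v) = a * f u + f v) ->
  f x = \sum_i x i 0 * f (basisv R i).
Proof.
move=> fL.
have f0 : f 0 = 0 by have := fL (-1) 0 0; rewrite scaler0 addr0; lra.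
have {1}-> : x = \sum_i x i 0 *: basisv R i.
  apply/colP => k; rewrite summxE (bigD1 k) //= big1 ?addr0.
    by rewrite mxE basisvE eqxx mulr1.
  by move=> l lk; rewrite mxE basisvE eq_sym (negbTE lk) mulr0.
by elim/big_rec2: _ => [//|i y1 y2 _ <-]; rewrite fL.
Qed.

Lemma dot_mulmx m p (A : 'M[R]_(m, p)) u v : dot (A *m u) v = dot u (A^T *m v).
Proof. by rewrite !dotE trmx_mul mulmxA. Qed.

Lemma mulmx_inj m p (A B : 'M[R]_(m, p)) :
  (forall u : 'cV[R]_p, A *m u = B *m u) -> A = B.
Proof.
move=> AB; apply/matrixP => i j; have /colP/(_ i) := AB (delta_mx j 0).
by rewrite -!colE !mxE.
Qed.

Variable n : nat.
Implicit Types (x y z t : 'cV[R]_n) (A B W : 'M[R]_(dimL2 n)).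
Implicit Types (eta zeta : 'cV[R]_(dimL2 n)).
Local Notation e := (@basisv R n).

Lemma wedge_linearl a u v y : wedge (a *: u + v) y = a *: wedge u y + wedge v y.
Proof. by apply/colP => k; rewrite !mxE; ring. Qed.

Lemma wedge_linearr a u v x : wedge x (a *: u + v) = a *: wedge x u + wedge x v.
Proof. by apply/colP => k; rewrite !mxE; ring. Qed.

Lemma wedgeC x y : wedge x y = - wedge y x.
Proof. by apply/colP => k; rewrite !mxE; ring. Qed.

Lemma lo_neq_hi (k : 'I_(dimL2 n)) : lo k != hi k.
Proof. by rewrite -val_eqE ltn_eqF // lo_lt_hi. Qed.

Lemma basisv_wedge (k : 'I_(dimL2 n)) : basisv R k = wedge (e (lo k)) (e (hi k)).
Proof.
apply/colP => l; rewrite basisvE !mxE !eqxx !andbT.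
have [->|lk] := eqVneq l k.
  by rewrite !eqxx (negbTE (lo_neq_hi k)) [_ == lo k]eq_sym (negbTE (lo_neq_hi k)) /=; ring.
have -> : ((lo l == lo k)%:R * (hi l == hi k)%:R : R) = 0.
  case: eqP => e1; case: eqP => e2 /=; rewrite ?mul0r ?mulr0 //.
  by case/eqP: lk; apply: lo_hi_inj.
have -> : ((hi l == lo k)%:R * (lo l == hi k)%:R : R) = 0.
  case: eqP => e1; case: eqP => e2 /=; rewrite ?mul0r ?mulr0 //.
  by move: (lo_lt_hi l) (lo_lt_hi k); rewrite e1 e2 => /ltn_trans h /h; rewrite ltnn.
by rewrite subr0.
Qed.

Definition rm A x y z t : R := dot (A *m wedge x y) (wedge z t).
Definition rc A a b c d : R := rm A (e a) (e b) (e c) (e d).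

Lemma rm_lin1 A a u v y z t :
  rm A (a *: u + v) y z t = a * rm A u y z t + rm A v y z t.
Proof. by rewrite /rm wedge_linearl mulmxDr -scalemxAr dot_linear. Qed.

Lemma rm_lin2 A a u v x z t :
  rm A x (a *: u + v) z t = a * rm A x u z t + rm A x v z t.
Proof. by rewrite /rm wedge_linearr mulmxDr -scalemxAr dot_linear. Qed.

Lemma rm_lin3 A a u v x y t :
  rm A x y (a *: u + v) t = a * rm A x y u t + rm A x y v t.
Proof. by rewrite /rm wedge_linearl dot_linearr. Qed.

Lemma rm_lin4 A a u v x y z :
  rm A x y z (a *: u + v) = a * rm A x y z u + rm A x y z v.
Proof. by rewrite /rm wedge_linearr dot_linearr. Qed.

Lemma rm_linop a A B x y z t :
  rm (a *: A + B) x y z t = a * rm A x y z t + rm B x y z t.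
Proof. by rewrite /rm mulmxDl -scalemxAl dot_linear. Qed.

Lemma rmZ1 A c x y z t : rm A (c *: x) y z t = c * rm A x y z t.
Proof. by apply: (linear_scale (f := fun u => rm A u y z t)) => *; exact: rm_lin1. Qed.

Lemma rmZ2 A c x y z t : rm A x (c *: y) z t = c * rm A x y z t.
Proof. by apply: (linear_scale (f := fun u => rm A x u z t)) => *; exact: rm_lin2. Qed.

Lemma rmZ3 A c x y z t : rm A x y (c *: z) t = c * rm A x y z t.
Proof. by apply: (linear_scale (f := fun u => rm A x y u t)) => *; exact: rm_lin3. Qed.

Lemma rmZ4 A c x y z t : rm A x y z (c *: t) = c * rm A x y z t.
Proof. by apply: (linear_scale (f := rm A x y z)) => *; exact: rm_lin4. Qed.

Lemma rmZop A c x y z t : rm (c *: A) x y z t = c * rm A x y z t.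
Proof. by apply: (linear_scale (f := fun u => rm u x y z t)) => *; exact: rm_linop. Qed.

Lemma dotNl m (u v : 'cV[R]_m) : dot (- u) v = - dot u v.
Proof. by rewrite /dot -sumrN; apply: eq_bigr => i _; rewrite mxE mulNr. Qed.

Lemma dotNr m (u v : 'cV[R]_m) : dot u (- v) = - dot u v.
Proof. by rewrite dotC dotNl dotC. Qed.

Lemma rm_anti1 A x y z t : rm A x y z t = - rm A y x z t.
Proof. by rewrite /rm wedgeC mulmxN dotNl. Qed.

Lemma rm_anti2 A x y z t : rm A x y z t = - rm A x y t z.
Proof. by rewrite /rm [wedge z t]wedgeC dotNr. Qed.

Lemma rm_sym A x y z t : A^T = A -> rm A x y z t = rm A z t x y.
Proof. by move=> As; rewrite /rm dot_mulmx As dotC. Qed.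

Lemma rc_anti1 A a b c d : rc A a b c d = - rc A b a c d.
Proof. exact: rm_anti1. Qed.

Lemma rc_anti2 A a b c d : rc A a b c d = - rc A a b d c.
Proof. exact: rm_anti2. Qed.

Lemma rc_diag1 A a c d : rc A a a c d = 0.
Proof. by have := rc_anti1 A a a c d; lra. Qed.

Lemma rc_diag2 A a b c : rc A a b c c = 0.
Proof. by have := rc_anti2 A a b c c; lra. Qed.

Lemma rc_sym A a b c d : curvop A -> rc A a b c d = rc A c d a b.
Proof. by case=> As _; exact: rm_sym. Qed.

Lemma rc_bianchi A a b c d : curvop A ->
  rc A a b c d + rc A a c d b + rc A a d b c = 0.
Proof.
move=> cA; case: (cA) => _ /(_ (e c) (e d) (e b) (e a)).
rewrite -/(rm _ _ _ _ _) -/(rm A (e b) _ _ _) -/(rm A (e d) _ _ _) -!/(rc _ _ _ _ _).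
rewrite (rc_sym _ _ _ _ cA) (rc_anti1 A b a) (rc_sym b c d a cA) (rc_anti1 A d a).
by rewrite (rc_sym d b c a cA) (rc_anti1 A c a); lra.
Qed.

Lemma entry_rc A k l : A k l = rc A (lo l) (hi l) (lo k) (hi k).
Proof.
by rewrite /rc /rm -!basisv_wedge dot_basisv /basisv -colE mxE.
Qed.

Lemma rc_inj A B : (forall a b c d, rc A a b c d = rc B a b c d) -> A = B.
Proof. by move=> AB; apply/matrixP => k l; rewrite !entry_rc AB. Qed.

Lemma ricci_rc A a b : ricci A a b = \sum_i rc A b i a i.
Proof. by rewrite mxE. Qed.

Lemma ricci_sym A : curvop A -> (ricci A)^T = ricci A.
Proof.
move=> cA; apply/matrixP => a b; rewrite mxE !ricci_rc.
by apply: eq_bigr => i _; rewrite rc_sym.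
Qed.

Lemma so_of_linear a eta zeta : so_of (a *: eta + zeta) = a *: so_of eta + so_of zeta.
Proof.
rewrite /so_of scaler_sumr -big_split /=; apply: eq_bigr => k _.
by rewrite !mxE scalerDl scalerA.
Qed.

Lemma so_of_trmx eta : (so_of eta)^T = - so_of eta.
Proof.
apply/matrixP => i j; rewrite [LHS]mxE [RHS]mxE !so_ofE -sumrN.
apply: eq_bigr => k _; rewrite -mulrN opprB.
by rewrite andbC [in X in _ - X]andbC.
Qed.

Lemma so_of_anti eta i j : so_of eta i j = - so_of eta j i.
Proof. by have /matrixP/(_ j i) := so_of_trmx eta; rewrite !mxE. Qed.

Lemma so_of_wedgeE x y : so_of (wedge x y) = y *m x^T - x *m y^T.
Proof.
apply: mulmx_inj => u; rewrite so_of_wedge mulmxBl -!mulmxA.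
by congr (_ - _); apply/colP => i; rewrite !mxE big_ord1 dotE mulrC.
Qed.

Lemma dot_so_of eta zeta : dot eta zeta = - 2^-1 * \tr (so_of eta *m so_of zeta).
Proof.
pose G i j := so_of eta i j * so_of zeta i j.
have so_k (v : 'cV[R]_(dimL2 n)) k : v k 0 = so_of v (hi k) (lo k).
  by rewrite -{1}(so_ofK v) mxE.
have -> : dot eta zeta = \sum_(k < dimL2 n) G (lo k) (hi k).
  apply: eq_bigr => k _; rewrite /G !so_k.
  by rewrite (so_of_anti eta) (so_of_anti zeta) mulrNN.
rewrite sum_opair /G.
- rewrite mulNr -mulrN; congr (_ * _); rewrite /mxtrace -sumrN.
  apply: eq_bigr => i _; rewrite mxE -sumrN; apply: eq_bigr => j _.
  by rewrite (so_of_anti zeta); ring.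
- by move=> i j; rewrite (so_of_anti eta) (so_of_anti zeta) mulrNN.
- by move=> i; have := so_of_anti eta i i; nra.
Qed.

Lemma lie_wedge eta x y :
  lie eta (wedge x y) = wedge (so_of eta *m x) y + wedge x (so_of eta *m y).
Proof.
apply: (can_inj (@so_ofK R n)); rewrite so_of_lie -[X in so_of (X + _)]scale1r.
rewrite so_of_linear scale1r !so_of_wedgeE !trmx_mul so_of_trmx.
rewrite !mulmxN !mulmxBr !mulmxBl !mulmxA.
by apply/matrixP => i j; rewrite !mxE; ring.
Qed.

Lemma dot_lie eta (u v : 'cV[R]_(dimL2 n)) : dot (lie eta u) v = - dot u (lie eta v).
Proof.
rewrite !dot_so_of !so_of_lie mulmxBl mulmxBr !raddfB /= !mulmxA.
rewrite [\tr (so_of u *m so_of v *m so_of eta)]mxtrace_mulC mulmxA.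
by ring.
Qed.

Lemma lieC eta zeta : lie eta zeta = - lie zeta eta.
Proof.
by rewrite /lie -[in RHS]opprB; apply/colP => k; rewrite !mxE opprK.
Qed.

Lemma lie_linearl zeta a (u v : 'cV[R]_(dimL2 n)) :
  lie (a *: u + v) zeta = a *: lie u zeta + lie v zeta.
Proof. by rewrite lieC (lie_linear zeta) opprD -scalerN -!lieC. Qed.

Lemma sharp_form_linear A zeta a (u v : 'cV[R]_(dimL2 n)) :
  sharp_form A (a *: u + v) zeta = a * sharp_form A u zeta + sharp_form A v zeta.
Proof.
rewrite /sharp_form mulrCA -mulrDr; congr (_ * _).
rewrite mulr_sumr -big_split; apply: eq_bigr => k _ /=.
by rewrite lie_linearl dot_linear.
Qed.

Lemma dot_sharp A eta zeta : dot (sharp A *m eta) zeta = sharp_form A eta zeta.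
Proof.
rewrite (linear_basisv (f := fun v => dot (sharp A *m v) zeta) eta); last first.
  by move=> a u v; rewrite mulmxDr -scalemxAr dot_linear.
rewrite (linear_basisv (f := fun v => sharp_form A v zeta) eta); last first.
  exact: sharp_form_linear.
apply: eq_bigr => k _; congr (_ * _).
rewrite (linear_basisv (f := dot (sharp A *m basisv R k)) zeta); last first.
  exact: dot_linearr.
rewrite sharp_formC (linear_basisv (f := fun v => sharp_form A v (basisv R k)) zeta); last first.
  exact: sharp_form_linear.
apply: eq_bigr => l _; congr (_ * _).
by rewrite dot_basisv /basisv -colE mxE mxE.
Qed.

(** Both halves of the derivation induced by [g] contribute equally, by exchanging [i] and [j]; this
    compensates the factor 1/2 between unordered and ordered pairs. *)
Lemma sum_derivation (g : 'M[R]_n) (f : 'I_n -> 'I_n -> 'cV[R]_(dimL2 n) -> R) :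
  (forall i j a u v, f i j (a *: u + v) = a * f i j u + f i j v) ->
  (forall i j u, f i j u = - f j i u) ->
  \sum_(k < dimL2 n) f (lo k) (hi k)
     (wedge (g *m e (lo k)) (e (hi k)) + wedge (e (lo k)) (g *m e (hi k)))
  = \sum_i \sum_j f i j (wedge (g *m e i) (e j)).
Proof.
move=> fL fA.
have fN i j u : f i j (- u) = - f i j u.
  have := fL i j (-1) u 0; have := fL i j (-1) 0 0.
  by rewrite scaler0 !addr0 scaleN1r; lra.
have fD i j u v : f i j (u + v) = f i j u + f i j v.
  by have := fL i j 1 u v; rewrite scale1r mul1r.
pose h i j := wedge (g *m e i) (e j) + wedge (e i) (g *m e j).
have hC i j : h i j = - h j i.
  by rewrite /h wedgeC [wedge (e i) _]wedgeC -opprD addrC.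
rewrite (sum_opair (G := fun i j => f i j (h i j))); last 2 first.
- by move=> i j; rewrite fA hC fN opprK.
- by move=> i; have := fA i i (h i i); lra.
under eq_bigr => i _ do under eq_bigr => j _ do rewrite fD.
under eq_bigr => i _ do rewrite big_split /=.
rewrite big_split /= [X in _ + X]exchange_big /=.
set S := (X in X + _).
have -> : \sum_j \sum_i f i j (wedge (e i) (g *m e j)) = S.
  apply: eq_bigr => i _; apply: eq_bigr => j _.
  by rewrite fA wedgeC fN opprK.
by rewrite -[RHS]/S; field.
Qed.

Lemma sum_lie_basisv eta (f : 'I_n -> 'I_n -> 'cV[R]_(dimL2 n) -> R) :
  (forall i j a u v, f i j (a *: u + v) = a * f i j u + f i j v) ->
  (forall i j u, f i j u = - f j i u) ->
  \sum_(k < dimL2 n) f (lo k) (hi k) (lie eta (basisv R k))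
  = \sum_i \sum_j f i j (wedge (so_of eta *m e i) (e j)).
Proof.
move=> fL fA; rewrite -(sum_derivation (so_of eta) fL fA).
by apply: eq_bigr => k _; rewrite basisv_wedge lie_wedge.
Qed.

(** Each bracket is made to act on a basis bivector, where it is a derivation: the outer one by
    skewness of [lie eta], which absorbs the minus sign, the inner one by expanding its argument in
    the basis. *)
Lemma sharp_form_rc A eta zeta : sharp_form A eta zeta =
  2^-1 * \sum_i \sum_j \sum_k \sum_l rc A i j k l
     * rm A (so_of zeta *m e k) (e l) (so_of eta *m e i) (e j).
Proof.
rewrite /sharp_form mulNr -mulrN; congr (_ * _); rewrite -sumrN.
pose f i j u := dot (A *m lie zeta (A *m wedge (e i) (e j))) u.
transitivity (\sum_p f (lo p) (hi p) (lie eta (basisv R p))).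
  by apply: eq_bigr => p _; rewrite dot_lie opprK /f -basisv_wedge.
rewrite sum_lie_basisv; last 2 first.
- by move=> *; rewrite /f dot_linearr.
- by move=> i j u; rewrite /f wedgeC mulmxN -!adE !mulmxN dotNl.
apply: eq_bigr => i _; apply: eq_bigr => j _; rewrite /f.
set w := wedge (so_of eta *m e i) (e j).
pose g k l u := rc A i j k l * dot (A *m u) w.
rewrite (linear_basisv (f := fun v => dot (A *m lie zeta v) w)); last first.
  by move=> a u v; rewrite lie_linear mulmxDr -scalemxAr dot_linear.
transitivity (\sum_p g (lo p) (hi p) (lie zeta (basisv R p))).
  by apply: eq_bigr => p _; rewrite /g /rc /rm -basisv_wedge dot_basisv.
rewrite sum_lie_basisv // /g.
  by move=> k l a u v; rewrite mulmxDr -scalemxAr dot_linear; ring.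
by move=> k l u; rewrite rc_anti2 mulNr.
Qed.

(** The endomorphism attached to the bivector of [e a] and [e m] has rank at most two: it sends
    [e a] to [e m], [e m] to [- e a], and is zero if [a = m]. *)
Lemma sum_so_wedge a m (f : 'I_n -> R) (F : 'cV[R]_n -> R) :
  (forall a u v, F (a *: u + v) = a * F u + F v) ->
  \sum_i f i * F (so_of (wedge (e a) (e m)) *m e i) = f a * F (e m) - f m * F (e a).
Proof.
move=> FL.
have F0 : F 0 = 0 by have := FL (-1) 0 0; rewrite scaler0 addr0; lra.
have E i : F (so_of (wedge (e a) (e m)) *m e i)
   = (a == i)%:R * F (e m) - (m == i)%:R * F (e a).
  have FZ c u : F (c *: u) = c * F u by have := FL c u 0; rewrite addr0 F0 addr0.
  rewrite so_of_wedge !dot_basisv !basisvE FL -scaleNr FZ.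
  by rewrite ![i == _]eq_sym; ring.
have D b (g : 'I_n -> R) : \sum_i g i * (b == i)%:R = g b.
  rewrite (bigD1 b) //= eqxx mulr1 big1 ?addr0 // => i.
  by rewrite eq_sym => /negbTE ->; rewrite mulr0.
under eq_bigr => i _ do rewrite E mulrBr !mulrA.
by rewrite sumrB -!mulr_suml !D.
Qed.

(** The curvature action on 2-tensors that occurs in the Lichnerowicz Laplacian; its value at the
    identity matrix is the transpose of [ricci A]. *)
Definition lw A (phi : 'M[R]_n) : 'M[R]_n :=
  \matrix_(a, b) \sum_j \sum_l rc A a j b l * phi j l.

Definition sum3 (F : 'I_n -> 'I_n -> 'I_n -> R) : R := \sum_m \sum_j \sum_l F m j l.

Lemma eq_sum3 F G : (forall m j l, F m j l = G m j l) -> sum3 F = sum3 G.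
Proof.
by move=> FG; do 3 (apply: eq_bigr => ? _).
Qed.

Lemma sum3D F G : sum3 (fun m j l => F m j l + G m j l) = sum3 F + sum3 G.
Proof.
rewrite /sum3 -big_split; apply: eq_bigr => m _ /=; rewrite -big_split.
by apply: eq_bigr => j _ /=; rewrite -big_split.
Qed.

Lemma sum3Z c F : sum3 (fun m j l => c * F m j l) = c * sum3 F.
Proof.
rewrite /sum3 mulr_sumr; apply: eq_bigr => m _; rewrite mulr_sumr.
by apply: eq_bigr => j _; rewrite mulr_sumr.
Qed.

Lemma sum3_13 F : sum3 F = sum3 (fun m j l => F l j m).
Proof.
rewrite /sum3 exchange_big [RHS]exchange_big; apply: eq_bigr => j _ /=.
by rewrite exchange_big.
Qed.

Lemma sum3_12 F : sum3 F = sum3 (fun m j l => F j m l).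
Proof. by rewrite /sum3 exchange_big. Qed.

(** The sharp form on two basis bivectors expands into four products of components, equal two by two
    by pair symmetry, which absorbs the factor 1/2. One pair contracts to a Ricci tensor; the other
    is cancelled by the square of [A] in [ricci_Qfield]. *)
Lemma ricci_sharp A a b : curvop A ->
  ricci (sharp A) a b
  = lw A (ricci A) a b - sum3 (fun m j l => rc A b j m l * rc A a l m j).
Proof.
move=> cA; rewrite ricci_rc.
have E m : rc (sharp A) b m a m = 2^-1 * \sum_j \sum_l (
    rc A b j a l * rc A m l m j - rc A b j m l * rc A a l m j
    - rc A m j a l * rc A m l b j + rc A m j m l * rc A a l b j).
  rewrite /rc /rm dot_sharp sharp_form_rc; congr (_ * _).
  rewrite exchange_big /=; apply: eq_bigr => j _.
  under eq_bigr => i _ do rewrite exchange_big /=.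
  rewrite exchange_big /=; apply: eq_bigr => l _.
  under eq_bigr => i _ do under eq_bigr => k _ do rewrite /rm.
  have F1 z i : \sum_k rc A i j k l *
     dot (A *m wedge (so_of (wedge (e a) (e m)) *m e k) (e l)) (wedge z (e j))
     = rc A i j a l * rm A (e m) (e l) z (e j) - rc A i j m l * rm A (e a) (e l) z (e j).
    rewrite (sum_so_wedge a m (rc A i j ^~ l) (F := fun u => rm A u (e l) z (e j))) //.
    by move=> *; apply: rm_lin1.
  under eq_bigr => i _ do rewrite F1.
  rewrite sumrB.
  rewrite (sum_so_wedge b m (fun i => rc A i j a l)
    (F := fun z => rm A (e m) (e l) z (e j))); last by move=> *; apply: rm_lin3.
  rewrite (sum_so_wedge b m (fun i => rc A i j m l)
    (F := fun z => rm A (e a) (e l) z (e j))); last by move=> *; apply: rm_lin3.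
  by rewrite -!/(rm _ _ _ _ _) -!/(rc _ _ _ _ _); ring.
under eq_bigr => m _ do rewrite E.
rewrite -mulr_sumr -/(sum3 _).
have -> : lw A (ricci A) a b = sum3 (fun m j l => rc A m j m l * rc A a l b j).
  rewrite /sum3 exchange_big /= mxE exchange_big /=; apply: eq_bigr => j _.
  rewrite exchange_big /=; apply: eq_bigr => l _.
  rewrite ricci_rc mulr_sumr; apply: eq_bigr => m _.
  by rewrite (rc_anti1 A j) (rc_anti2 A m j); ring.
rewrite -sum3Z -mulN1r -sum3Z -sum3D; apply: eq_sum3 => m j l.
rewrite (rc_sym b j a l cA) (rc_sym m l m j cA) (rc_sym m j a l cA).
by rewrite (rc_sym m l b j cA); lra.
Qed.

Lemma ricci_sqr A a b : curvop A ->
  ricci (A *m A) a b = 2^-1 * sum3 (fun m j l => rc A b j m l * rc A a j m l).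
Proof.
move=> cA; case: (cA) => As _; rewrite ricci_rc sum3_12 /sum3 mulr_sumr.
apply: eq_bigr => m _; rewrite /rc /rm -mulmxA dot_mulmx As.
rewrite -sum_opair; last 2 first.
- by move=> i j; rewrite [X in X * _]rm_anti2 [X in _ * X]rm_anti2 mulrNN.
- by move=> i; have := rc_diag2 A b m i; rewrite /rc /rm => ->; rewrite mul0r.
by apply: eq_bigr => p _; rewrite /rm -basisv_wedge !dot_basisv.
Qed.

Lemma ricci_Qfield A : curvop A -> ricci (Qfield A) = lw A (ricci A).
Proof.
move=> cA; apply/matrixP => a b.
have -> : ricci (Qfield A) a b = ricci (A *m A) a b + ricci (sharp A) a b.
  rewrite !ricci_rc -big_split; apply: eq_bigr => i _ /=.
  by rewrite /rc /Qfield -[A *m A]scale1r rm_linop scale1r mul1r.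
rewrite ricci_sqr // ricci_sharp //.
set Y := (X in _ - X); set S := (X in _ * X).
(* After relabelling, the three sums share the factor [rc A b j m l], and the cofactors add up to
   the cyclic sum of the first Bianchi identity. *)
suff : Y + Y - S = 0 by lra.
have SE : S = sum3 (fun m j l => - (rc A b j m l * rc A a j l m)).
  by apply: eq_sum3 => m j l; rewrite (rc_anti2 A a j m); ring.
have YE : Y = sum3 (fun m j l => rc A b j m l * rc A a m j l).
  rewrite /Y sum3_13; apply: eq_sum3 => m j l.
  by rewrite (rc_anti2 A b) (rc_anti2 A a m l j); ring.
rewrite SE -mulN1r -sum3Z {2}YE /Y -!sum3D.
rewrite [LHS](eq_sum3 (G := fun m j l => 0 * 0)) ?sum3Z ?mul0r // => m j l.
by have := rc_bianchi a l m j cA; nra.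
Qed.

End Bivectors.

(** * Ricci decomposition *)

Section Decomposition.
Variables (R : realType) (n : nat).
Implicit Types (x y z t : 'cV[R]_n) (A B W : 'M[R]_(dimL2 n)).
Implicit Types (phi psi g h : 'M[R]_n).
Local Notation e := (@basisv R n).

Lemma curvop_linear a A B : curvop A -> curvop B -> curvop (a *: A + B).
Proof.
move=> [As Ab] [Bs Bb]; split; first by rewrite linearP /= As Bs.
move=> x y z t; rewrite -/(rm _ _ _ _ _) -/(rm _ z x y t) -/(rm _ y z x t).
rewrite !rm_linop; have := Ab x y z t; have := Bb x y z t.
by rewrite /rm; nra.
Qed.

Lemma curvop0 : curvop (0 : 'M[R]_(dimL2 n)).
Proof.
split; first by rewrite trmx0.
by move=> x y z t; rewrite !mul0mx /dot !big1 ?addr0 // => i _; rewrite mxE mul0r.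
Qed.

Lemma curvopZ a A : curvop A -> curvop (a *: A).
Proof. by move=> cA; rewrite -[_ *: _]addr0; apply: curvop_linear => //; exact: curvop0. Qed.

Lemma curvopB A B : curvop A -> curvop B -> curvop (A - B).
Proof. by move=> cA cB; rewrite addrC -scaleN1r; exact: curvop_linear. Qed.

Lemma ricci_linear a A B : ricci (a *: A + B) = a *: ricci A + ricci B.
Proof.
apply/matrixP => i j; rewrite ricci_rc 2!mxE !ricci_rc mulr_sumr -big_split.
by apply: eq_bigr => k _; rewrite /rc rm_linop.
Qed.

Lemma ricci0 : ricci (0 : 'M[R]_(dimL2 n)) = 0.
Proof.
have := ricci_linear (-1) 0 0; rewrite scaler0 addr0 => ->.
by rewrite scaleN1r addNr.
Qed.

Lemma ricciZ a A : ricci (a *: A) = a *: ricci A.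
Proof. by have := ricci_linear a A 0; rewrite ricci0 !addr0. Qed.

Lemma ricciD A B : ricci (A + B) = ricci A + ricci B.
Proof. by have := ricci_linear 1 A B; rewrite !scale1r. Qed.

Lemma ricciB A B : ricci (A - B) = ricci A - ricci B.
Proof. by rewrite ricciD -scaleN1r ricciZ scaleN1r. Qed.

(** An alternating bilinear form factors through the exterior square; this evaluates [kn], defined
    on basis bivectors, at any [wedge x y]. *)
Lemma alternating_wedge (b : 'cV[R]_n -> 'cV[R]_n -> R) x y :
  (forall a u v w, b (a *: u + v) w = a * b u w + b v w) ->
  (forall u v, b u v = - b v u) ->
  \sum_k b (e (lo k)) (e (hi k)) * wedge x y k 0 = b x y.
Proof.
move=> bL bA.
have bL' a u v w : b w (a *: u + v) = a * b w u + b w v.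
  by rewrite bA bL (bA u) (bA v); ring.
pose G i j := b (e i) (e j) * (x i 0 * y j 0 - x j 0 * y i 0).
have -> : \sum_k b (e (lo k)) (e (hi k)) * wedge x y k 0
   = \sum_(k < dimL2 n) G (lo k) (hi k).
  by apply: eq_bigr => k _; rewrite mxE.
rewrite sum_opair /G; last 2 first.
- by move=> i j; rewrite bA; ring.
- by move=> i; ring.
have -> : b x y = \sum_i \sum_j b (e i) (e j) * (x i 0 * y j 0).
  rewrite (linear_basisv (f := b^~ y)) //; apply: eq_bigr => i _.
  rewrite (linear_basisv (f := b (e i))) // mulr_sumr.
  by apply: eq_bigr => j _; ring.
under eq_bigr => i _ do under eq_bigr => j _ do rewrite mulrBr.
under eq_bigr => i _ do rewrite sumrB.
rewrite sumrB [X in _ - X]exchange_big /= -sumrB.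
rewrite mulr_sumr; apply: eq_bigr => i _; rewrite -sumrB mulr_sumr.
by apply: eq_bigr => j _; rewrite [b (e j) _]bA; field.
Qed.

(* The Kulkarni-Nomizu product of [phi] with the metric. *)
Definition kn phi : 'M[R]_(dimL2 n) :=
  \matrix_(k, l) (wedge (phi *m e (lo l)) (e (hi l))
                  + wedge (e (lo l)) (phi *m e (hi l))) k 0.

Lemma kn_wedge phi x y : kn phi *m wedge x y = wedge (phi *m x) y + wedge x (phi *m y).
Proof.
apply/colP => k; rewrite mxE.
pose b u v := (wedge (phi *m u) v + wedge u (phi *m v)) k 0.
have bD u v : b u v = wedge (phi *m u) v k 0 + wedge u (phi *m v) k 0.
  by rewrite /b mxE.
rewrite -[RHS]/(b x y) -(@alternating_wedge b).
- by apply: eq_bigr => l _; rewrite mxE.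
- move=> a u v w; rewrite !bD mulmxDr -scalemxAr !wedge_linearl.
  by rewrite ![in LHS]mxE; rewrite ![in RHS]mxE; ring.
- move=> u v; rewrite !bD (wedgeC (phi *m u)) (wedgeC u).
  by rewrite [X in X + _]mxE [X in _ + X]mxE; ring.
Qed.

Lemma rm_kn phi x y z t : rm (kn phi) x y z t =
  dot (phi *m x) z * dot y t - dot (phi *m x) t * dot y z
  + (dot x z * dot (phi *m y) t - dot x t * dot (phi *m y) z).
Proof.
by rewrite /rm kn_wedge -!dot_wedge -[X in dot (X + _)]scale1r dot_linear mul1r.
Qed.

Lemma curvop_kn phi : phi^T = phi -> curvop (kn phi).
Proof.
move=> ps; have S u v : dot (phi *m u) v = dot (phi *m v) u.
  by rewrite dot_mulmx ps dotC.
split.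
  apply/matrixP => k l; rewrite mxE !entry_rc /rc !rm_kn.
  by rewrite !(S (e (lo l))) !(S (e (hi l))) ![dot _ (e (lo l))]dotC ![dot _ (e (hi l))]dotC; ring.
move=> x y z t; rewrite -/(rm _ _ _ _ _) -/(rm _ z x y t) -/(rm _ y z x t) !rm_kn.
rewrite (dotC y x) (dotC z x) (dotC z y) (S y x) (S z x) (S z y).
by ring.
Qed.

Lemma kn1 : kn 1%:M = 2 *: 1%:M.
Proof.
apply: rc_inj => a b c d; rewrite /rc rm_kn !mul1mx.
by rewrite -[X in rm X]addr0 rm_linop /rm mul1mx mul0mx dot_wedge
  dotC [dot 0 _]big1 ?addr0 => [|i _]; [ring | rewrite mxE mul0r].
Qed.

Lemma mul_basisv phi i j : (phi *m e i) j 0 = phi j i.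
Proof. by rewrite /basisv -colE mxE. Qed.

Lemma sum_delta (f : 'I_n -> R) a : \sum_i f i * (i == a)%:R = f a.
Proof.
rewrite (bigD1 a) //= eqxx mulr1 big1 ?addr0 // => i /negbTE ->.
by rewrite mulr0.
Qed.

Lemma ricci_kn phi : ricci (kn phi) = (n%:R - 2) *: phi + (\tr phi) *: 1%:M.
Proof.
apply/matrixP => a b; rewrite ricci_rc !mxE.
under eq_bigr => i _ do rewrite /rc rm_kn !dot_basisv !mul_basisv !basisvE eqxx mulr1.
transitivity (\sum_i (phi a b - phi i b * (i == a)%:R + phi i i * (a == b)%:R
   - phi a i * (i == b)%:R)).
  by apply: eq_bigr => i _; rewrite (eq_sym i a); ring.
rewrite sumrB big_split /= sumrB !sum_delta sumr_const card_ord -mulr_suml.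
by rewrite -mulr_natl -/(\tr phi); ring.
Qed.

Definition ip phi psi : R := \sum_i \sum_j phi i j * psi i j.

(** Adjointness of the Kulkarni-Nomizu map and the Ricci contraction. It lets an operator without
    Weyl part be replaced, in every pairing, by a symmetric matrix. *)
Lemma tr_kn phi A : phi^T = phi -> \tr (kn phi *m A) = ip phi (ricci A).
Proof.
move=> ps; have [ks _] := curvop_kn ps.
pose f i j u := dot (A *m wedge (e i) (e j)) u.
transitivity (\sum_k f (lo k) (hi k)
  (wedge (phi *m e (lo k)) (e (hi k)) + wedge (e (lo k)) (phi *m e (hi k)))).
  apply: eq_bigr => k _; rewrite /f -kn_wedge -!basisv_wedge.
  by rewrite dotC dot_mulmx ks mulmxA dotC dot_basisv /basisv -colE [RHS]mxE.
rewrite sum_derivation /f; last 2 first.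
- by move=> i j a u v; rewrite dot_linearr.
- by move=> i j u; rewrite wedgeC mulmxN dotNl.
rewrite /ip [RHS]exchange_big /=; apply: eq_bigr => i _.
under [RHS]eq_bigr => k _ do rewrite ricci_rc mulr_sumr.
rewrite [RHS]exchange_big /=; apply: eq_bigr => j _.
rewrite -/(rm A (e i) (e j) _ (e j)).
rewrite (linear_basisv (f := fun u => rm A (e i) (e j) u (e j))); last first.
  by move=> *; rewrite rm_lin3.
by apply: eq_bigr => k _; rewrite mul_basisv.
Qed.

Lemma ip_scalar psi a : ip a%:M psi = a * \tr psi.
Proof.
rewrite /ip /mxtrace mulr_sumr; apply: eq_bigr => i _.
rewrite -(sum_delta (fun j => a * psi i j)); apply: eq_bigr => j _.
by rewrite [a%:M i j]mxE -mulr_natr (eq_sym i); ring.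
Qed.

Lemma tr_ricci A : \tr (ricci A) = 2 * \tr A.
Proof.
have := @tr_kn 1%:M A (trmx1 _ _); rewrite kn1 -scalemxAl mul1mx mxtraceZ => ->.
by rewrite ip_scalar mul1r.
Qed.

(** The coefficients solve [(n%:R - 2) *: P + \tr P *: 1%:M = r] for [P], so that [kn P] has Ricci
    tensor [r]. *)
Definition schouten r : 'M[R]_n :=
  (n%:R - 2)^-1 *: (r - (\tr r / (2 * (n%:R - 1))) *: 1%:M).

Definition kn_lift r : 'M[R]_(dimL2 n) := kn (schouten r).

Lemma schouten_sym r : r^T = r -> (schouten r)^T = schouten r.
Proof. by move=> rs; rewrite /schouten linearZ /= linearB /= linearZ /= rs trmx1. Qed.

Lemma curvop_lift r : r^T = r -> curvop (kn_lift r).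
Proof. by move=> rs; apply/curvop_kn/schouten_sym. Qed.

Hypothesis n_ge4 : (4 <= n)%N.

Lemma nR_ge4 : 4 <= n%:R :> R.
Proof. by rewrite (ler_nat R 4 n). Qed.

Lemma ricci_lift r : ricci (kn_lift r) = r.
Proof.
have n4 := nR_ge4; rewrite ricci_kn /schouten scalerA mulfV ?scale1r; last by lra.
rewrite mxtraceZ raddfB /= mxtraceZ mxtrace1.
apply/matrixP => i j; rewrite !mxE; field.
by apply/andP; split; lra.
Qed.

Lemma tr_lift r A : r^T = r -> \tr (kn_lift r *m A) = ip (schouten r) (ricci A).
Proof. by move=> rs; apply/tr_kn/schouten_sym. Qed.

Definition weyl A : 'M[R]_(dimL2 n) := A - kn_lift (ricci A).

Lemma curvop_weyl A : curvop A -> curvop (weyl A).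
Proof. by move=> cA; apply: curvopB => //; apply/curvop_lift/ricci_sym. Qed.

Lemma ricci_weyl A : ricci (weyl A) = 0.
Proof. by rewrite ricciB ricci_lift subrr. Qed.

End Decomposition.

(** * Action of signed permutations *)

Section Action.
Variables (R : realType) (n : nat).
Implicit Types (x y z t : 'cV[R]_n) (A B W X Y : 'M[R]_(dimL2 n)).
Implicit Types (phi psi g h : 'M[R]_n) (w : 'I_n -> 'I_n -> R).
Local Notation e := (@basisv R n).

Lemma rm_act g A x y z t :
  rm (act g A) x y z t = rm A (g *m x) (g *m y) (g *m z) (g *m t).
Proof. exact: act_wedge. Qed.

Lemma act_sum g (I : finType) (F : I -> 'M[R]_(dimL2 n)) :
  act g (\sum_i F i) = \sum_i act g (F i).
Proof. by rewrite /act mulmx_sumr mulmx_suml. Qed.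

Lemma actZ g a A : act g (a *: A) = a *: act g A.
Proof. by rewrite /act -scalemxAr -scalemxAl. Qed.

Lemma actB g A B : act g (A - B) = act g A - act g B.
Proof. by rewrite /act mulmxBr mulmxBl. Qed.

Lemma act_act g h A : act g (act h A) = act (h *m g) A.
Proof. by apply: rc_inj => a b c d; rewrite /rc !rm_act !mulmxA. Qed.

Lemma act1 A : act 1%:M A = A.
Proof. by apply: rc_inj => a b c d; rewrite /rc rm_act !mul1mx. Qed.

Lemma curvop_act g A : curvop A -> curvop (act g A).
Proof.
move=> [As Ab]; split; first by rewrite /act !trmx_mul trmxK As mulmxA.
by move=> x y z t; rewrite -/(rm _ _ _ _ _) -/(rm _ z x y t) -/(rm _ y z x t) !rm_act; exact: Ab.
Qed.

Lemma tr_act B g A : \tr (B *m act g A) = \tr (A *m act g^T B).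
Proof.
have E : ext2 g^T = (ext2 g)^T by apply/matrixP => k l; rewrite !mxE; ring.
rewrite /act E trmxK !mulmxA mxtrace_mulC !mulmxA.
by rewrite mxtrace_mulC !mulmxA.
Qed.

Lemma orthogonal_mxM g h :
  orthogonal_mx g -> orthogonal_mx h -> orthogonal_mx (g *m h).
Proof.
move=> og oh; rewrite /orthogonal_mx trmx_mul mulmxA -(mulmxA _ g^T) og.
by rewrite mulmx1.
Qed.

Lemma orthogonal_mx_tr g : orthogonal_mx g -> orthogonal_mx g^T.
Proof. by move=> og; rewrite /orthogonal_mx trmxK; exact: mulmx1C. Qed.

Lemma ricci_act_flat g A : orthogonal_mx g -> ricci A = 0 -> ricci (act g A) = 0.
Proof.
move=> og A0; have /orthogonal_mx_tr := og; rewrite /orthogonal_mx trmxK => gg.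
apply/matrixP => a b; rewrite ricci_rc mxE.
set x := g *m e b; set y := g *m e a.
pose M : 'M[R]_n := \matrix_(u, v) rm A x (e u) y (e v).
(* The Ricci entry is the trace of the form [M] in the frame [g *m e i], and a trace does not depend
   on the orthonormal frame. *)
transitivity (\tr (g^T *m M *m g)).
  apply: eq_bigr => i _; rewrite /rc rm_act -/x -/y !mxE.
  rewrite (linear_basisv (f := fun z => rm A x (g *m e i) y z)); last first.
    by move=> *; rewrite rm_lin4.
  apply: eq_bigr => v _; rewrite mul_basisv mulrC; congr (_ * _).
  rewrite (linear_basisv (f := fun z => rm A x z y (e v))) ?mxE; last first.
    by move=> *; rewrite rm_lin2.
  by apply: eq_bigr => u _; rewrite mul_basisv !mxE.
rewrite mxtrace_mulC mulmxA gg mul1mx.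
transitivity (dot (ricci A *m x) y).
  by rewrite ricciE; apply: eq_bigr => i _; rewrite mxE.
by rewrite A0 mul0mx /dot big1 // => i _; rewrite mxE mul0r.
Qed.

Definition sgn (s : {ffun 'I_n -> bool}) : 'M[R]_n := diag_mx (\row_i (-1) ^+ s i).

Lemma sgn_basisv s i : sgn s *m e i = (-1) ^+ s i *: e i.
Proof.
apply/colP => j; rewrite mul_basisv !mxE !eqxx !andbT.
by case: eqP => [->|_]; rewrite ?mulr1n ?mulr0n ?mulr1 ?mulr0.
Qed.

Lemma sgn_orthogonal s : orthogonal_mx (sgn s).
Proof.
apply: mulmx_inj => u; rewrite mul1mx /sgn tr_diag_mx mulmx_diag.
have -> : (\row_j ((\row_i (-1) ^+ s i) 0 j * (\row_i (-1) ^+ s i) 0 j)) = const_mx 1 :> 'rV[R]_n.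
  by apply/rowP => i; rewrite !mxE -expr2 sqrr_sign.
by rewrite diag_const_mx mul1mx.
Qed.

(** The inverse is taken because [perm_mx s] sends [e (s i)] to [e i]. *)
Definition pmx (s : 'S_n) : 'M[R]_n := perm_mx (s^-1)%g.

Lemma pmx_basisv s i : pmx s *m e i = e (s i).
Proof.
apply/colP => j; rewrite mul_basisv !mxE !eqxx !andbT /=.
by rewrite -(inj_eq (@perm_inj _ s)) permKV.
Qed.

Lemma pmx_orthogonal s : orthogonal_mx (pmx s).
Proof. by rewrite /orthogonal_mx /pmx tr_perm_mx -perm_mxM ?mulgV ?mulVg perm_mx1. Qed.

Lemma rc_sgn s A a b c d : rc (act (sgn s) A) a b c d =
  (-1) ^+ s a * (-1) ^+ s b * (-1) ^+ s c * (-1) ^+ s d * rc A a b c d.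
Proof.
by rewrite /rc rm_act !sgn_basisv rmZ1 rmZ2 rmZ3 rmZ4; ring.
Qed.

Lemma rc_pmx s A a b c d : rc (act (pmx s) A) a b c d = rc A (s a) (s b) (s c) (s d).
Proof. by rewrite /rc rm_act !pmx_basisv. Qed.

(** For symmetric [w] these are curvature operators fixed by all sign changes, and [w a b] with
    [a != b] is the sectional curvature of a coordinate plane. *)
Definition dg w : 'M[R]_(dimL2 n) := diag_mx (\row_k w (lo k) (hi k)).

Definition dw A a b : R := rc A a b a b.

Definition symw w := forall a b, w a b = w b a.

Lemma dw_sym A : symw (dw A).
Proof. by move=> a b; rewrite /dw rc_anti1 rc_anti2 opprK. Qed.

Lemma rc_dg w a b c d : symw w ->
  rc (dg w) a b c d = w a b * ((a == c)%:R * (b == d)%:R - (a == d)%:R * (b == c)%:R).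
Proof.
move=> ws; rewrite /rc /rm.
have -> : dg w *m wedge (e a) (e b) = w a b *: wedge (e a) (e b) + 0.
  apply/colP => k; rewrite /dg mul_diag_mx !mxE !eqxx !andbT addr0.
  rewrite !mulrBr; congr (_ - _).
    by have [->|] := eqVneq (lo k) a; have [->|] := eqVneq (hi k) b; rewrite //= ?(mulr0, mul0r).
  have [->|] := eqVneq (hi k) a; have [->|] := eqVneq (lo k) b; rewrite //= ?(mulr0, mul0r) //.
  by rewrite ws.
rewrite dot_linear [dot 0 _]big1 ?addr0; last by move=> i _; rewrite mxE mul0r.
by rewrite dot_wedge !dot_basisv !basisvE ![c == _]eq_sym ![d == _]eq_sym.
Qed.

Lemma curvop_dg w : symw w -> curvop (dg w).
Proof.
move=> ws; split; first by rewrite tr_diag_mx.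
move=> x y z t; rewrite -/(rm _ _ _ _ _) -/(rm _ z x y t) -/(rm _ y z x t).
have E u v p q : rm (dg w) u v p q = 2^-1 * \sum_i \sum_j
   w i j * (u i 0 * v j 0 - u j 0 * v i 0) * (p i 0 * q j 0 - p j 0 * q i 0).
  rewrite -sum_opair; last 2 first.
  - by move=> i j; rewrite ws; ring.
  - by move=> i; ring.
  by rewrite /rm /dot; apply: eq_bigr => k _; rewrite /dg mul_diag_mx !mxE.
rewrite !E -!mulrDr -!big_split big1 ?mulr0 // => i _ /=.
rewrite -!big_split big1 // => j _ /=; ring.
Qed.

Lemma ricci_dg w : symw w -> (forall a, w a a = 0) -> (forall a, \sum_b w a b = 0) ->
  ricci (dg w) = 0.
Proof.
move=> ws w0 wr; apply/matrixP => a b; rewrite ricci_rc mxE.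
under eq_bigr => i _ do rewrite rc_dg // eqxx mulr1.
transitivity ((b == a)%:R * \sum_i w b i - w b b * (b == a)%:R).
  rewrite mulr_sumr -(sum_delta (fun i => w b i * (b == a)%:R) b) -sumrB.
  apply: eq_bigr => i _; rewrite (eq_sym b i).
  by case: (eqVneq i b) => [->|_] /=; ring.
by rewrite w0 wr; ring.
Qed.

Lemma act_pmx_dg s w : symw w -> act (pmx s) (dg w) = dg (fun a b => w (s a) (s b)).
Proof.
move=> ws; have ws' : symw (fun a b => w (s a) (s b)) by move=> a b; exact: ws.
apply: rc_inj => a b c d; rewrite rc_pmx !rc_dg //.
by rewrite !(inj_eq perm_inj).
Qed.

Lemma dg_sum (I : finType) (F : I -> 'I_n -> 'I_n -> R) :
  \sum_i dg (F i) = dg (fun a b => \sum_i F i a b).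
Proof.
apply/matrixP => k l; rewrite summxE !mxE.
under eq_bigr => i _ do rewrite !mxE.
by rewrite -sumrMnl.
Qed.

Definition nsgn : R := #|{: {ffun 'I_n -> bool}}|%:R.

Lemma nsgn_neq0 : nsgn != 0.
Proof. by rewrite pnatr_eq0 card_ffun card_bool card_ord -lt0n expn_gt0. Qed.

(** Flipping the sign at [i] is an involution that negates every summand, since [i] occurs an odd
    number of times among the indices. *)
Lemma sum_sgn_odd i a b c d :
  (i == a) (+) (i == b) (+) (i == c) (+) (i == d) ->
  \sum_(s : {ffun 'I_n -> bool})
    ((-1) ^+ s a * (-1) ^+ s b * (-1) ^+ s c * (-1) ^+ s d) = 0 :> R.
Proof.
move=> odd; set S := LHS; suff : S = - S by lra.
pose flip (s : {ffun 'I_n -> bool}) := [ffun j => s j (+) (i == j)].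
have flipK : involutive flip.
  by move=> s; apply/ffunP => j; rewrite !ffunE addbK.
rewrite {1}/S (reindex_inj (inv_inj flipK)) /S -sumrN; apply: eq_bigr => s _.
rewrite !ffunE !signr_addb.
have E : (-1) ^+ (i == a) * (-1) ^+ (i == b) * (-1) ^+ (i == c) * (-1) ^+ (i == d) = -1 :> R.
  by rewrite -!signr_addb odd.
have {}E u : - u =
    (-1) ^+ (i == a) * (-1) ^+ (i == b) * (-1) ^+ (i == c) * (-1) ^+ (i == d) * u :> R.
  by rewrite E mulN1r.
by rewrite [RHS]E; ring.
Qed.

(** A component survives the average only if every index occurs an even number of times; it is then
    zero by antisymmetry or, up to sign, a sectional curvature. *)
Lemma sum_act_sgn A : curvop A ->
  \sum_s act (sgn s) A = nsgn *: dg (dw A).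
Proof.
move=> cA; apply: rc_inj => a b c d.
have -> : rc (nsgn *: dg (dw A)) a b c d = nsgn * rc (dg (dw A)) a b c d.
  exact: rmZop.
have -> : rc (\sum_s act (sgn s) A) a b c d = \sum_s rc (act (sgn s) A) a b c d.
  elim/big_rec2: _ => [|s u v _ <-].
    by rewrite /rc /rm mul0mx [dot 0 _]big1 // => i _; rewrite mxE mul0r.
  by rewrite -[act _ _]scale1r /rc rm_linop mul1r scale1r.
rewrite rc_dg; last exact: dw_sym.
under eq_bigr => s _ do rewrite rc_sgn.
rewrite -mulr_suml.
have [->|ab] := eqVneq a b; first by rewrite /dw !rc_diag1 mulr0 mul0r mulr0.
have [->|cd] := eqVneq c d; first by rewrite rc_diag2; ring.
have one (u v : 'I_n) : \sum_(s : {ffun 'I_n -> bool})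
  ((-1) ^+ s u * (-1) ^+ s v * (-1) ^+ s u * (-1) ^+ s v) = nsgn.
  rewrite /nsgn -sumr_const; apply: eq_bigr => s _.
  by case: (s u); case: (s v) => /=; ring.
have one' (u v : 'I_n) : \sum_(s : {ffun 'I_n -> bool})
  ((-1) ^+ s u * (-1) ^+ s v * (-1) ^+ s v * (-1) ^+ s u) = nsgn.
  by rewrite -(one u v); apply: eq_bigr => s _; ring.
have [ac|ac] := eqVneq a c.
  have [bd|bd] := eqVneq b d.
    by rewrite -ac -bd one (negbTE ab) /= /dw; ring.
  rewrite (@sum_sgn_odd b) ?mul0r //; first by rewrite -ac [b == a]eq_sym (negbTE ab) /=; ring.
  by rewrite eqxx -ac eq_sym (negbTE ab) (negbTE bd).
have [ad|ad] := eqVneq a d.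
  have [bc|bc] := eqVneq b c.
    by rewrite -ad -bc one' /dw (rc_anti2 _ a b b a) /=; ring.
  rewrite (@sum_sgn_odd b) ?mul0r //; first by rewrite /=; ring.
  by rewrite eqxx -ad eq_sym (negbTE ab) (negbTE bc).
rewrite (@sum_sgn_odd a) ?mul0r //; first by rewrite /=; ring.
by rewrite eqxx (negbTE ab) (negbTE ac) (negbTE ad).
Qed.

(** The group average takes the same value at all pairs [a, j] with [j != a], while its row at [a]
    still sums to zero. *)
Lemma sum_perm_weights w a b : a != b -> symw w ->
  (forall a, w a a = 0) -> (forall a, \sum_b w a b = 0) ->
  \sum_(s : 'S_n) w (s a) (s b) = 0.
Proof.
move=> ab ws w0 wr; pose F a b := \sum_(s : 'S_n) w (s a) (s b).
have Ft (t : 'S_n) u v : F (t u) (t v) = F u v.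
  rewrite /F [RHS](reindex_inj (mulgI t)) /=.
  by apply: eq_bigr => s _; rewrite !permM.
have Fc j : j != a -> F a j = F a b.
  move=> ja; rewrite -(Ft (tperm b j) a b) tpermL tpermD // eq_sym //.
have : \sum_j F a j = 0.
  rewrite /F exchange_big big1 //= => s _.
  by rewrite -[RHS](wr (s a)) [RHS](reindex_inj (@perm_inj _ s)).
rewrite (bigD1 a) //= {1}/F big1 ?add0r; last by move=> s _; exact: w0.
rewrite (eq_bigr (fun=> F a b)) // sumr_const -mulr_natr => /eqP.
rewrite mulf_eq0 pnatr_eq0 => /orP[/eqP //|/eqP c0].
by have := card0_eq c0 b; rewrite unfold_in /= eq_sym ab.
Qed.

Lemma dw_flat A : curvop A -> ricci A = 0 ->
  (forall a, dw A a a = 0) /\ (forall a, \sum_b dw A a b = 0).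
Proof.
move=> cA A0; split=> a; first exact: rc_diag1.
by have /matrixP/(_ a a) := A0; rewrite ricci_rc mxE.
Qed.

Lemma sum_orbit_flat A : curvop A -> ricci A = 0 ->
  \sum_(s : 'S_n) \sum_(t : {ffun 'I_n -> bool}) act (sgn t *m pmx s) A = 0.
Proof.
move=> cA A0; have [w0 wr] := dw_flat cA A0.
under eq_bigr => s _ do (under eq_bigr => t _ do rewrite -act_act).
under eq_bigr => s _ do
  rewrite -act_sum sum_act_sgn // actZ (act_pmx_dg _ (dw_sym A)).
rewrite -scaler_sumr dg_sum.
apply/matrixP => k l; rewrite !mxE sum_perm_weights ?mul0rn ?mulr0 //.
  exact: lo_neq_hi.
exact: dw_sym.
Qed.

End Action.

(** * Irreducibility of the Ricci-flat operators *)

Section Irreducibility.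
Variables (R : realType) (n : nat).
Hypothesis n_ge4 : (4 <= n)%N.
Implicit Types (x y z t : 'cV[R]_n) (A B W X Y Z : 'M[R]_(dimL2 n)).
Implicit Types (g h : 'M[R]_n) (w : 'I_n -> 'I_n -> R).
Local Notation e := (@basisv R n).

(* The reflection of vector [e j + 2 e k], which mixes [e j] and [e k] with
   rational coefficients. *)
Definition rfl (j k : 'I_n) : 'M[R]_n :=
  1%:M - (2 / 5) *: ((e j + 2 *: e k) *m (e j + 2 *: e k)^T).

Lemma rfl_basisv j k i :
  rfl j k *m e i = e i - ((2 / 5) * dot (e j + 2 *: e k) (e i)) *: (e j + 2 *: e k).
Proof.
rewrite /rfl mulmxBl mul1mx -scalemxAl -mulmxA -scalerA; congr (_ - _ *: _).
by apply/colP => l; rewrite !mxE big_ord1 dotE !mxE mulrC.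
Qed.

Lemma dot_e i j : dot (e i) (e j) = (i == j)%:R.
Proof. by rewrite dot_basisv basisvE eq_sym. Qed.

Lemma dot_rfl j k i : dot (e j + 2 *: e k) (e i) = (j == i)%:R + 2 * (k == i)%:R.
Proof. by rewrite addrC dot_linear !dot_e addrC. Qed.

Lemma rfl_j j k : j != k -> rfl j k *m e j = (3 / 5) *: e j + (- (4 / 5)) *: e k.
Proof.
move=> jk; rewrite rfl_basisv dot_rfl eqxx eq_sym (negbTE jk) /=.
by apply/colP => l; rewrite !mxE; field.
Qed.

Lemma rfl_id j k i : j != i -> k != i -> rfl j k *m e i = e i.
Proof.
move=> ji ki; rewrite rfl_basisv dot_rfl (negbTE ji) (negbTE ki).
by rewrite mulr0 addr0 mulr0 scale0r subr0.
Qed.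

Lemma rfl_orthogonal j k : j != k -> orthogonal_mx (rfl j k).
Proof.
move=> jk; rewrite /orthogonal_mx /rfl; set v := e j + _.
have vv : v^T *m v = 5%:M.
  apply/matrixP => p q; rewrite !ord1 -dotE /v addrC dot_linear !dot_linearr !dot_e.
  by rewrite !eqxx [k == j]eq_sym (negbTE jk) mxE eqxx /=; ring.
have -> : (1%:M - (2 / 5) *: (v *m v^T))^T = 1%:M - (2 / 5) *: (v *m v^T).
  by rewrite linearB /= linearZ /= trmx1 trmx_mul trmxK.
rewrite mulmxBl mul1mx mulmxBr mulmx1 -scalemxAl -!scalemxAr mulmxA -(mulmxA v) vv.
rewrite mul_mx_scalar -scalemxAl.
by apply/matrixP => p q; rewrite !mxE; field.
Qed.

(** Sectional curvatures determine the operator. The polarisation moves the operator itself by the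
    reflections [rfl], which is why the hypothesis ranges over its whole orthogonal orbit. *)
Lemma curvop_eq0 X : curvop X ->
  (forall g, orthogonal_mx g -> forall i j, dw (act g X) i j = 0) -> X = 0.
Proof.
pose H Y := curvop Y /\ forall g, orthogonal_mx g -> forall i j, dw (act g Y) i j = 0.
have HA Y g : H Y -> orthogonal_mx g -> H (act g Y).
  move=> [cY hY] og; split; first exact: curvop_act.
  by move=> h oh i j; rewrite act_act hY //; exact: orthogonal_mxM.
have o1 : orthogonal_mx (1%:M : 'M[R]_n) by rewrite /orthogonal_mx trmx1 mul1mx.
have H0 Y i j : H Y -> rc Y i j i j = 0.
  by move=> [_ /(_ _ o1 i j)]; rewrite act1.
have H1 Y i j k : H Y -> i != j -> i != k -> j != k -> rc Y i j i k = 0.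
  move=> HY ij ik jk; have := H0 _ i j (HA _ _ HY (rfl_orthogonal jk)).
  rewrite /rc rm_act rfl_id 1?eq_sym // rfl_j // rm_lin2 rmZ2 !rm_lin4 !rmZ4 -!/(rc _ _ _ _ _).
  have [cY _] := HY; rewrite !H0 // (rc_sym i k i j cY); lra.
(* Applying [H1] after mixing [e i] with [e l] leaves only the cross terms, which gives skewness in
   the first and third indices. *)
have H2 Y i j k l : H Y -> uniq [:: i; j; k; l] -> rc Y i j l k = - rc Y l j i k.
  move=> HY; rewrite /= !inE !negb_or => /and4P[/and3P[ij ik il] /andP[jk jl] kl _].
  have := H1 _ i j k (HA _ _ HY (rfl_orthogonal il)) ij ik jk.
  rewrite /rc rm_act (rfl_id (i := j)) 1?(rfl_id (i := k)) 1?[l == _]eq_sym // rfl_j //.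
  rewrite rm_lin1 rmZ1 !rm_lin3 !rmZ3 -!/(rc _ _ _ _ _).
  by rewrite !H1 // 1?eq_sym //; lra.
(* By [H2] the component is invariant under cyclic permutations of its last three indices, so
   Bianchi says that three times it is zero. *)
have H3 Y i j k l : H Y -> uniq [:: i; j; k; l] -> rc Y i j k l = 0.
  move=> HY U; have [cY _] := HY.
  have U1 : uniq [:: i; k; l; j].
    by rewrite (perm_uniq (s2 := [:: i; j; k; l])) // perm_cons (perm_catC [:: k; l] [:: j]).
  have U2 : uniq [:: i; l; j; k].
    by rewrite (perm_uniq (s2 := [:: i; j; k; l])) // perm_cons (perm_catC [:: l] [:: j; k]).
  have F a b c d : uniq [:: a; b; c; d] -> rc Y a b c d = rc Y a c d b.
    move=> V; rewrite (rc_anti2 Y a b c d) (H2 _ _ _ _ _ HY V) opprK.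
    by rewrite (rc_sym d b a c cY) (rc_anti2 Y a c d b) (rc_anti1 Y a c) (rc_anti1 Y c a); lra.
  have := rc_bianchi i j k l cY.
  by have := F _ _ _ _ U; have := F _ _ _ _ U1; lra.
move=> cX hX; have HX : H X by [].
apply: rc_inj => a b c d; rewrite [rc 0 _ _ _ _](_ : _ = 0); last first.
  by rewrite /rc /rm mul0mx /dot big1 // => i _; rewrite mxE mul0r.
have [->|ab] := eqVneq a b; first exact: rc_diag1.
have [->|cd] := eqVneq c d; first exact: rc_diag2.
have [ac|ac] := eqVneq a c.
  rewrite -ac in cd *.
  have [<-|bd] := eqVneq b d; first exact: H0.
  exact: H1.
have [ad|ad] := eqVneq a d.
  rewrite -ad in cd *; rewrite rc_anti2.
  have [<-|bc] := eqVneq b c; first by rewrite H0 ?oppr0.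
  by rewrite H1 ?oppr0.
have [bc|bc] := eqVneq b c.
  rewrite -bc in cd ac *; rewrite rc_anti1 H1 ?oppr0 // eq_sym //.
have [bd|bd] := eqVneq b d.
  rewrite -bd in cd ad *; rewrite rc_anti1 rc_anti2 opprK H1 // 1?eq_sym //.
by apply: H3 => //; rewrite /= !inE !negb_or ab ac ad bc bd cd.
Qed.

(** Summing the cycle relation over the fourth vertex makes the weights of adjacent edges equal;
    zero row sums then leave only the zero weight. *)
Lemma weights_eq0 w : symw w -> (forall a, w a a = 0) -> (forall a, \sum_b w a b = 0) ->
  (forall i j k l, uniq [:: i; j; k; l] -> w i j - w j k + w k l - w l i = 0) ->
  forall a b, w a b = 0.
Proof.
move=> ws w0 wr wc; have n4 := nR_ge4 R n_ge4.
have E i j k : i != j -> i != k -> j != k -> w i j = w j k.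
  move=> ij ik jk; set d := w i j - w j k.
  (* The row sums give [n%:R * d]; only [l = i, j, k] escape the cycle relation, and they contribute
     [2 * d] in all. *)
  have : \sum_l (d + w k l - w l i) = n%:R * d.
    rewrite sumrB big_split /= wr addr0 sumr_const card_ord mulr_natl.
    by rewrite (eq_bigr (w i)) ?wr ?subr0 // => l _; exact: ws.
  rewrite (bigD1 i) //= (bigD1 j) 1?eq_sym //= (bigD1 k) /=; last first.
    by rewrite ![k == _]eq_sym ik jk.
  rewrite big1 ?addr0; last first.
    move=> l /andP[/andP[li lj] lk]; apply: wc.
    by rewrite /= !inE !negb_or ij ik jk ![_ == l]eq_sym li lj lk.
  rewrite !w0 (ws k j) (ws j i) (ws k i); rewrite -/d.
  have -> : d + w j k - w i j = 0 by rewrite /d; ring.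
  by move=> h; suff : d = 0 by [rewrite /d; lra]; nra.
move=> i j; have [->|ij] := eqVneq i j; first exact: w0.
have : \sum_k (w j k - w i j) = - n%:R * w i j.
  by rewrite sumrB wr sumr_const card_ord -mulr_natl; ring.
rewrite (bigD1 j) //= (bigD1 i) //= big1 ?addr0; last first.
  by move=> k /andP[kj ki]; rewrite (E i j k) ?subrr // eq_sym.
by rewrite w0 (ws j i); nra.
Qed.

(* The weights +1, -1, +1, -1 along the 4-cycle i j k l. *)
Definition cycw (i j k l a b : 'I_n) : R :=
  ((a == i)%:R - (a == k)%:R) * ((b == j)%:R - (b == l)%:R)
  + ((a == j)%:R - (a == l)%:R) * ((b == i)%:R - (b == k)%:R).

Lemma cycw_sym i j k l : symw (cycw i j k l).
Proof. by move=> a b; rewrite /cycw; ring. Qed.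

Lemma cycw_diag i j k l a : uniq [:: i; j; k; l] -> cycw i j k l a a = 0.
Proof.
rewrite /= !inE !negb_or => /and4P[/and3P[ij ik il] /andP[jk jl] kl _].
rewrite /cycw; have [->|ai] := eqVneq a i.
  by rewrite (negbTE ij) (negbTE il); ring.
have [->|aj] := eqVneq a j; first by rewrite (negbTE jk); ring.
have [->|ak] := eqVneq a k; first by rewrite (negbTE kl); ring.
by ring.
Qed.

Lemma cycw_row i j k l a : \sum_b cycw i j k l a b = 0.
Proof.
have D (c : 'I_n) : \sum_b (b == c)%:R = 1 :> R.
  by rewrite -[RHS](sum_delta (fun=> 1) c); apply: eq_bigr => b _; rewrite mul1r.
by rewrite big_split /= -!mulr_sumr !sumrB !D; ring.
Qed.

Lemma cycw_ij i j k l : uniq [:: i; j; k; l] -> cycw i j k l i j = 1.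
Proof.
rewrite /= !inE !negb_or => /and4P[/and3P[ij ik il] /andP[jk jl] kl _].
by rewrite /cycw !eqxx (negbTE ij) (negbTE ik) (negbTE il) (negbTE jl) /=; ring.
Qed.

(** The left side antisymmetrises [w] under the commuting transpositions of [i, k] and of [j, l]. An
    edge not joining one of these pairs to the other is fixed by one transposition and cancels; the
    four remaining edges carry the same alternating sum up to sign. *)
Lemma cycle_weights w i j k l a b : uniq [:: i; j; k; l] -> symw w ->
  w a b - w (tperm i k a) (tperm i k b) - w (tperm j l a) (tperm j l b)
    + w (tperm i k (tperm j l a)) (tperm i k (tperm j l b))
  = (w i j - w j k + w k l - w l i) * cycw i j k l a b.
Proof.
rewrite /= !inE !negb_or => /and4P[/and3P[ij ik il] /andP[jk jl] kl _] ws.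
rewrite /cycw !permE /=.
(case: (eqVneq a i) => [->|ai]; last case: (eqVneq a j) => [->|aj];
  last case: (eqVneq a k) => [->|ak]; last case: (eqVneq a l) => [->|al]);
(case: (eqVneq b i) => [->|bi]; last case: (eqVneq b j) => [->|bj];
  last case: (eqVneq b k) => [->|bk]; last case: (eqVneq b l) => [->|bl]);
repeat (match goal with
  | H : is_true (?x != ?y) |- context [?x == ?y] => rewrite (negbTE H)
  | H : is_true (?x != ?y) |- context [?y == ?x] => rewrite (eq_sym y x) (negbTE H)
  | |- context [?x == ?x] => rewrite (eqxx x)
  end; rewrite /=);
rewrite ?(ws j i) ?(ws k j) ?(ws l k) ?(ws i l) ?(ws l j) ?(ws k i); ring.
Qed.

Lemma flat_cycle X : curvop X -> ricci X = 0 -> X <> 0 ->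
  exists g i j k l, [/\ orthogonal_mx g, uniq [:: i; j; k; l] &
    dw (act g X) i j - dw (act g X) j k + dw (act g X) k l - dw (act g X) l i != 0].
Proof.
move=> cX X0 Xn0; apply: contrapT => H; apply: Xn0; apply: curvop_eq0 => // g og.
have [w0 wr] := dw_flat (curvop_act g cX) (ricci_act_flat og X0).
apply: weights_eq0 => //; first exact: dw_sym.
move=> i j k l U; apply: contrapT => /eqP c0; apply: H.
by exists g, i, j, k, l.
Qed.

(** The operators whose orbit is orthogonal to [Y] form an invariant subspace. It contains the sign
    average of a suitable translate of [X], which is diagonal, and its antisymmetrisation, a nonzero
    multiple of a cycle operator. *)
Lemma orbit_cycle X Y : curvop X -> ricci X = 0 -> X <> 0 ->
  (forall g, orthogonal_mx g -> \tr (Y *m act g X) = 0) ->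
  exists i j k l, uniq [:: i; j; k; l] /\
    forall g, orthogonal_mx g -> \tr (Y *m act g (dg (cycw i j k l))) = 0.
Proof.
move=> cX X0 Xn0 XY.
have [g0 [i [j [k [l [og0 U c0]]]]]] := flat_cycle cX X0 Xn0.
exists i, j, k, l; split=> //.
pose P Z := forall g, orthogonal_mx g -> \tr (Y *m act g Z) = 0.
have PZ a Z : P Z -> P (a *: Z).
  by move=> PZ g og; rewrite actZ -scalemxAr mxtraceZ PZ ?mulr0.
have PB Z1 Z2 : P Z1 -> P Z2 -> P (Z1 - Z2).
  by move=> P1 P2 g og; rewrite actB mulmxBr raddfB /= P1 ?P2 ?subr0.
have PA g Z : orthogonal_mx g -> P Z -> P (act g Z).
  by move=> og PZ' h oh; rewrite act_act PZ' //; exact: orthogonal_mxM.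
pose w := dw (act g0 X); have ws : symw w by exact: dw_sym.
have Pw : P (dg w).
  have -> : dg w = (nsgn R n)^-1 *: \sum_s act (sgn R s) (act g0 X).
    rewrite sum_act_sgn; last exact: curvop_act.
    by rewrite scalerA mulVf ?scale1r // nsgn_neq0.
  apply: (PZ) => g og; rewrite act_sum mulmx_sumr raddf_sum big1 //= => s _.
  by apply: (PA) => //; [exact: sgn_orthogonal | exact: PA].
have Pt (s : 'S_n) Z : P Z -> P (act (pmx R s) Z).
  by move=> PZ'; apply: PA => //; exact: pmx_orthogonal.
set c := (X in X != 0) in c0.
have -> : dg (cycw i j k l) = c^-1 *: ((dg w - act (pmx R (tperm i k)) (dg w))
    - act (pmx R (tperm j l)) (dg w - act (pmx R (tperm i k)) (dg w))).
  have ws' : symw (fun a b => w (tperm i k a) (tperm i k b)) by move=> a b; exact: ws.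
  rewrite actB !act_pmx_dg //.
  apply/matrixP => p q; rewrite !mxE -!mulrnBl mulrnAr.
  congr (_ *+ _); have := cycle_weights (lo p) (hi p) U ws.
  rewrite -/c => E; apply: (mulfI c0); rewrite -E mulrA mulfV // mul1r.
  by ring.
by apply: PZ; apply: (PB); [|apply: (Pt)]; apply: (PB) => //; exact: Pt.
Qed.

Lemma perm_extend (s : 'S_n) a b : exists s' : 'S_n, s' a = b /\
  forall c, c != a -> s c != b -> s' c = s c.
Proof.
exists (s * tperm (s a) b)%g; rewrite permM tpermL; split=> // c ca cb.
by rewrite permM tpermD // eq_sym // (inj_eq perm_inj).
Qed.

(** All cycle operators thus lie in one orbit, which lets [flat_irreducible] compare two of them. *)
Lemma perm_4tuple (i j k l i' j' k' l' : 'I_n) :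
  uniq [:: i; j; k; l] -> uniq [:: i'; j'; k'; l'] ->
  exists s : 'S_n, [/\ s i = i', s j = j', s k = k' & s l = l'].
Proof.
rewrite /= !inE !negb_or => /and4P[/and3P[ij ik il] /andP[jk jl] kl _].
move=> /and4P[/and3P[ij' ik' il'] /andP[jk' jl'] kl' _].
have [s1 [s1i _]] := perm_extend 1%g i i'.
have [s2 [s2j s2P]] := perm_extend s1 j j'.
have s2i : s2 i = i' by rewrite s2P ?s1i.
have [s3 [s3k s3P]] := perm_extend s2 k k'.
have s3i : s3 i = i' by rewrite s3P ?s2i.
have s3j : s3 j = j' by rewrite s3P ?s2j.
have [s4 [s4l s4P]] := perm_extend s3 l l'.
by exists s4; split=> //; rewrite s4P ?s3i ?s3j ?s3k.
Qed.

Lemma tr_sqr_eq0 m (A : 'M[R]_m) : A^T = A -> \tr (A *m A) = 0 -> A = 0.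
Proof.
move=> As; rewrite -{1}As /mxtrace => /eqP.
have E i : (A^T *m A) i i = \sum_j A j i ^+ 2.
  by rewrite mxE; apply: eq_bigr => j _; rewrite mxE expr2.
under eq_bigr => i _ do rewrite E.
rewrite psumr_eq0; last by move=> i _; apply: sumr_ge0 => j _; exact: sqr_ge0.
move=> /allP H; apply/matrixP => j i; rewrite mxE.
have := H i (mem_index_enum _); rewrite psumr_eq0; last by move=> *; exact: sqr_ge0.
move=> /allP/(_ j (mem_index_enum _)) /=.
by rewrite sqrf_eq0 => /eqP.
Qed.

(** By [orbit_cycle], [Y] is orthogonal to the orbit of a cycle operator [th]; by adjointness and
    [orbit_cycle] again, [th] is orthogonal to the orbit of another cycle operator. That orbit
    contains [th], which would have norm zero. *)
Lemma flat_irreducible X Y : curvop X -> curvop Y -> ricci X = 0 -> ricci Y = 0 ->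
  X <> 0 -> (forall g, orthogonal_mx g -> \tr (Y *m act g X) = 0) -> Y = 0.
Proof.
move=> cX cY X0 Y0 Xn0 XY; apply: contrapT => Yn0.
have [i [j [k [l [U H1]]]]] := orbit_cycle cX X0 Xn0 XY.
set th := dg _ in H1.
have H2 g : orthogonal_mx g -> \tr (th *m act g Y) = 0.
  by move=> og; rewrite tr_act H1 //; exact: orthogonal_mx_tr.
have [i' [j' [k' [l' [U' H3]]]]] := orbit_cycle cY Y0 Yn0 H2.
have [s [si sj sk sl]] := perm_4tuple U U'.
have := H3 _ (pmx_orthogonal R s).
rewrite act_pmx_dg; last exact: cycw_sym.
have -> : dg (fun a b => cycw i' j' k' l' (s a) (s b)) = th.
  by congr dg; apply: funext => a; apply: funext => b;
    rewrite /cycw -si -sj -sk -sl !(inj_eq perm_inj).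
move/tr_sqr_eq0 => th0.
have : rc th i j i j = 0.
  rewrite th0; first by rewrite /rc /rm mul0mx /dot big1 // => p _; rewrite mxE mul0r.
  by rewrite /th tr_diag_mx.
rewrite rc_dg; last exact: cycw_sym.
move: (U); rewrite /= !inE !negb_or => /and4P[/and3P[ij _ _] _ _ _].
by rewrite cycw_ij // !eqxx (negbTE ij) /=; lra.
Qed.

(* An operator of the dual cone is nonnegative on the orbit of a Ricci-flat
   operator, whose average over signed permutations vanishes. *)
Lemma weyl_dual_eq0 B A : curvop B -> curvop A -> ricci A = 0 -> A <> 0 ->
  (forall g, orthogonal_mx g -> 0 <= \tr (B *m act g A)) -> weyl B = 0.
Proof.
move=> cB cA A0 An0 BA.
have BA0 g : orthogonal_mx g -> \tr (B *m act g A) = 0.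
  move=> og; have cgA := curvop_act g cA; have gA0 := ricci_act_flat og A0.
  pose F (p : 'S_n * {ffun 'I_n -> bool}) :=
    \tr (B *m act (sgn R p.2 *m pmx R p.1) (act g A)).
  have Fge0 p : 0 <= F p.
    rewrite /F act_act; apply: BA; apply: orthogonal_mxM => //.
    by apply: orthogonal_mxM; [exact: sgn_orthogonal | exact: pmx_orthogonal].
  have : \sum_p F p = 0.
    have := sum_orbit_flat cgA gA0; rewrite pair_big /= => S0.
    by rewrite /F -raddf_sum -mulmx_sumr S0 mulmx0 raddf0.
  (* Nonnegative terms with zero sum all vanish; the trivial permutation with trivial signs gives
     the term at [g] itself. *)
  move/eqP; rewrite psumr_eq0 // => /allP/(_ (1%g, [ffun=> false]) (mem_index_enum _)) /=.
  rewrite /F /= (_ : sgn R _ *m pmx R _ = 1%:M) ?act1; first by move/eqP.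
  rewrite /pmx invg1 perm_mx1 mulmx1 /sgn.
  have -> : \row_i (-1) ^+ [ffun=> false] i = const_mx 1 :> 'rV[R]_n.
    by apply/rowP => p; rewrite !mxE ffunE expr0.
  exact: diag_const_mx.
apply: (@flat_irreducible A) => //; first exact: curvop_weyl.
- exact: ricci_weyl.
move=> g og; rewrite /weyl mulmxBl raddfB /= BA0 // tr_lift; last exact: ricci_sym.
rewrite ricci_act_flat // /ip big1 ?subr0 // => a _; rewrite big1 // => b _.
by rewrite [fun_of_matrix 0 _ _]mxE mulr0.
Qed.

End Irreducibility.

(** * Separation of closed cones of matrices *)

Section Frobenius.
Variable R : realType.

(** Heine-Borel for row vectors, transported along [vec_mx]. *)
Lemma mx_bounded_closed_compact m p (S : set 'M[R]_(m, p)) (M : R) :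
  (forall A, S A -> forall i j, `|A i j| <= M) -> closed S -> compact S.
Proof.
move=> SM Scl.
have vecC : continuous (@vec_mx R m p).
  move=> v s /nbhs_ballP[e e0 es]; apply/nbhs_ballP; exists e => //= u [_ vu].
  by apply: es; split => // i j; rewrite !mxE; exact: vu.
pose T := @vec_mx R m p @^-1` S.
have Tcl : closed T by apply: closed_comp => // v _; exact: vecC.
have -> : S = @vec_mx R m p @` T.
  apply/seteqP; split => [A SA|_ [v Tv <-] //].
  by exists (mxvec A); rewrite /T /= mxvecK.
apply: continuous_compact; first by apply: continuous_subspaceT => v; exact: vecC.
apply: bounded_closed_compact => //; exists `|M|; split; first exact: num_real.
move=> M' MM' v Tv; rewrite /= [`|v|]mx_normrE.
apply/bigmax_leP; split=> [|[i k] _ /=]; first by apply: le_trans (ltW MM').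
rewrite ord1; case/mxvec_indexP: k => a b.
apply: le_trans (ltW MM'); apply: le_trans (ler_norm _).
by have := SM _ Tv a b; rewrite mxE.
Qed.

Lemma sum_continuous (T : topologicalType) (I : finType) (F : I -> T -> R) :
  (forall i, continuous (F i)) -> continuous (fun x => \sum_i F i x).
Proof.
move=> Fc; apply: continuous_big => //.
exact: (@add_continuous R).
Qed.

Lemma mul_continuous (T : topologicalType) (f g : T -> R) :
  continuous f -> continuous g -> continuous (fun x => f x * g x).
Proof. by move=> fc gc x; apply: cvgM; [exact: fc | exact: gc]. Qed.

Lemma shift_continuous (T : topologicalType) (f : T -> R) c :
  continuous f -> continuous (fun x => f x - c).
Proof. by move=> fc x; apply: cvgB; [exact: fc | exact: cvg_cst]. Qed.

Lemma linear_mx_continuous m p (f : 'M[R]_(m, p) -> R) :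
  (forall a u v, f (a *: u + v) = a * f u + f v) -> continuous f.
Proof.
move=> fL; have f0 : f 0 = 0 by have := fL (-1) 0 0; rewrite scaler0 addr0; lra.
have fD u v : f (u + v) = f u + f v by rewrite -[u]scale1r fL mul1r scale1r.
have fs (I : finType) (F : I -> 'M[R]_(m, p)) : f (\sum_i F i) = \sum_i f (F i).
  by elim/big_rec2: _ => [//|i u v _ <-]; rewrite fD.
have -> : f = fun A => \sum_i \sum_j A i j * f (delta_mx i j).
  apply: funext => A; rewrite {1}(matrix_sum_delta A) fs; apply: eq_bigr => i _.
  by rewrite fs; apply: eq_bigr => j _; rewrite linear_scale.
apply: sum_continuous => i; apply: sum_continuous => j; apply: mul_continuous.
  exact: coord_continuous.
exact: cst_continuous.
Qed.

Lemma closed_halfspace m p (f : 'M[R]_(m, p) -> R) :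
  (forall a u v, f (a *: u + v) = a * f u + f v) -> closed [set A | 0 <= f A].
Proof.
move=> /linear_mx_continuous fc; apply: (@closed_comp _ _ f [set x | 0 <= x]).
  by move=> x _; exact: fc.
exact: closed_ge.
Qed.

Variable m : nat.
Implicit Types A B X : 'M[R]_m.

Lemma ipC A B : ip A B = ip B A.
Proof. by apply: eq_bigr => i _; apply: eq_bigr => j _; rewrite mulrC. Qed.

Lemma ip_linear X a A B : ip (a *: A + B) X = a * ip A X + ip B X.
Proof.
rewrite /ip mulr_sumr -big_split; apply: eq_bigr => i _ /=.
rewrite mulr_sumr -big_split; apply: eq_bigr => j _ /=.
by rewrite !mxE; ring.
Qed.

Lemma ipDl A B X : ip (A + B) X = ip A X + ip B X.
Proof. by rewrite -[A]scale1r ip_linear mul1r scale1r. Qed.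

Lemma ipZl a A X : ip (a *: A) X = a * ip A X.
Proof. exact: (linear_scale (f := fun u => ip u X) a A (@ip_linear X)). Qed.

Lemma ipBl A B X : ip (A - B) X = ip A X - ip B X.
Proof. by rewrite addrC -scaleN1r ip_linear mulN1r addrC. Qed.

Lemma ipDr A B X : ip X (A + B) = ip X A + ip X B.
Proof. by rewrite !(ipC X) ipDl. Qed.

Lemma ipZr a A X : ip X (a *: A) = a * ip X A.
Proof. by rewrite !(ipC X) ipZl. Qed.

Lemma ipBr A B X : ip X (A - B) = ip X A - ip X B.
Proof. by rewrite !(ipC X) ipBl. Qed.

Lemma ip_sqrD t A B :
  ip (A + t *: B) (A + t *: B) = ip A A + 2 * t * ip A B + t ^+ 2 * ip B B.
Proof. by rewrite !(ipDl, ipDr) !(ipZl, ipZr) (ipC B A); ring. Qed.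

Lemma ip_ge0 A : 0 <= ip A A.
Proof. by apply: sumr_ge0 => i _; apply: sumr_ge0 => j _; rewrite -expr2 sqr_ge0. Qed.

Lemma ip_entry A i j : A i j ^+ 2 <= ip A A.
Proof.
rewrite /ip (bigD1 i) //= (bigD1 j) //= -expr2 -addrA lerDl.
apply: addr_ge0; first by apply: sumr_ge0 => ? _; rewrite -expr2 sqr_ge0.
by apply: sumr_ge0 => ? _; apply: sumr_ge0 => ? _; rewrite -expr2 sqr_ge0.
Qed.

Lemma ip_eq0 A : ip A A = 0 -> A = 0.
Proof.
move=> A0; apply/matrixP => i j; rewrite mxE; apply/eqP; rewrite -sqrf_eq0.
by rewrite eq_le sqr_ge0 -A0 ip_entry.
Qed.

Lemma tr_ip A B : A^T = A -> \tr (A *m B) = ip A B.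
Proof.
move=> As; rewrite /ip exchange_big; apply: eq_bigr => i _; rewrite mxE.
by apply: eq_bigr => j _; rewrite -{1}As mxE.
Qed.

Lemma ip_sqr_continuous (L : 'M[R]_m -> 'M[R]_m) B :
  (forall a u v, L (a *: u + v) = a *: L u + L v) ->
  continuous (fun A => ip (L A - B) (L A - B)).
Proof.
move=> LL; apply: sum_continuous => i; apply: sum_continuous => j.
have c : continuous (fun A => (L A - B) i j).
  have -> : (fun A => (L A - B) i j) = (fun A => L A i j - B i j).
    by apply: funext => A; rewrite !mxE.
  have Lc : continuous (fun A => L A i j).
    by apply: linear_mx_continuous => a u v; rewrite LL !mxE.
  exact: shift_continuous.
exact: (mul_continuous c c).
Qed.

(** One-sided first-order condition; the range stops at 1 so that it applies along segments of
    convex sets. If [b < 0], the time [t] below satisfies [t * c <= - b], so the quadratic is at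
    most [t * b < 0]. *)
Lemma quad_ge0 (b c : R) : (forall t, 0 < t -> t <= 1 -> 0 <= 2 * t * b + t ^+ 2 * c) -> 0 <= b.
Proof.
move=> H; rewrite leNgt; apply/negP => b0.
have c0 : 0 < c by have := H 1 ltr01 (lexx _); lra.
pose t := Num.min 1 (- b / c).
have t0 : 0 < t by rewrite lt_min ltr01 divr_gt0 // oppr_gt0.
have t1 : t <= 1 by rewrite ge_min lexx.
have tb : t * c <= - b by rewrite -ler_pdivlMr // ge_min lexx orbT.
by have := H t t0 t1; nra.
Qed.

(* The separating functional is the displacement to the nearest point of [C]. *)
Lemma cone_separation (C : set 'M[R]_m) A : closed C -> C 0 ->
  (forall X Y, C X -> C Y -> C (X + Y)) ->
  (forall a X, 0 <= a -> C X -> C (a *: X)) -> ~ C A ->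
  exists2 P, C P & (forall X, C X -> 0 <= ip (P - A) X) /\ ip (P - A) A < 0.
Proof.
move=> Ccl C0 CD CZ nCA.
pose f X := ip (X - A) (X - A).
have fc : continuous f by apply: (@ip_sqr_continuous id).
pose S := C `&` [set X | f X <= f 0].
have Scl : closed S.
  apply: closedI => //; apply: (@closed_comp _ _ f [set x | x <= f 0]).
    by move=> x _; exact: fc.
  exact: closed_le.
have Sco : compact S.
  (* The bound comes from [|x| <= x ^+ 2 + 1], applied to the entries of [A] and of [X - A]. *)
  apply: (@mx_bounded_closed_compact _ _ _ (ip A A + 1 + (f 0 + 1))) => // X [_ /= fX] i j.
  have h1 := ip_entry (X - A) i j; have h2 := ip_entry A i j.
  have sq (x K : R) : x ^+ 2 <= K -> - (K + 1) <= x <= K + 1.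
    by move=> xK; apply/andP; split; nra.
  have /andP[a1 a2] := sq _ _ (le_trans h1 fX); have /andP[b1 b2] := sq _ _ h2.
  by rewrite !mxE in a1 a2; rewrite ler_norml; apply/andP; split; lra.
have S0 : S !=set0 by exists 0; split=> //=.
have [P /set_mem[CP fP] Pmin] := compact_EVT_min S0 Sco (continuous_subspaceT fc).
have {}Pmin X : C X -> f P <= f X.
  move=> CX; have [fX|/ltW fX] := leP (f X) (f 0); last exact: le_trans fX.
  by apply: Pmin; apply/mem_set; split.
have expand X t : f (P + t *: X) = f P + 2 * t * ip (P - A) X + t ^+ 2 * ip X X.
  by rewrite /f addrAC ip_sqrD.
have pos X : C X -> 0 <= ip (P - A) X.
  move=> CX; apply: (@quad_ge0 _ (ip X X)) => t t0 _.
  have := Pmin (P + t *: X) (CD _ _ CP (CZ _ _ (ltW t0) CX)).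
  by rewrite expand; lra.
(* The point [P] can be shrunk as well as stretched inside [C]; [t <= 1] keeps the factor [1 - t]
   nonnegative. *)
have PP : ip (P - A) P = 0.
  apply/eqP; rewrite eq_le pos // andbT -oppr_ge0.
  apply: (@quad_ge0 _ (ip P P)) => t t0 t1.
  have := Pmin (P + (- t) *: P); rewrite expand sqrrN => H.
  suff : C (P + (- t) *: P) by move/H; lra.
  rewrite -[X in X + _]scale1r -scalerDl; apply: CZ => //; lra.
exists P => //; split=> //.
have : ip (P - A) (P - A) = - ip (P - A) A by rewrite ipBr PP sub0r.
have := ip_ge0 (P - A); rewrite le_eqVlt => /orP[/eqP/esym/ip_eq0/eqP|]; last by lra.
by rewrite subr_eq0 => /eqP PA; case: nCA; rewrite -PA.
Qed.

End Frobenius.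

(** * Invariant cones *)

Section RicciAction.
Variables (R : realType) (n : nat).
Implicit Types (A W : 'M[R]_(dimL2 n)) (phi psi : 'M[R]_n).

Lemma lw_linear W a phi psi : lw W (a *: phi + psi) = a *: lw W phi + lw W psi.
Proof.
apply/matrixP => i j; rewrite !mxE mulr_sumr -big_split; apply: eq_bigr => k _ /=.
rewrite mulr_sumr -big_split; apply: eq_bigr => l _ /=.
by rewrite !mxE; ring.
Qed.

Lemma lw_linearop a A W phi : lw (a *: A + W) phi = a *: lw A phi + lw W phi.
Proof.
apply/matrixP => i j; rewrite !mxE mulr_sumr -big_split; apply: eq_bigr => k _ /=.
rewrite mulr_sumr -big_split; apply: eq_bigr => l _ /=.
by rewrite /rc rm_linop; ring.
Qed.

Lemma lw_self_adjoint W phi psi : curvop W -> ip (lw W phi) psi = ip phi (lw W psi).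
Proof.
move=> cW.
have E f g : ip f (lw W g)
    = \sum_a \sum_b \sum_j \sum_l rc W a j b l * f a b * g j l.
  apply: eq_bigr => a _; apply: eq_bigr => b _; rewrite [lw W g a b]mxE mulr_sumr.
  apply: eq_bigr => j _; rewrite mulr_sumr; apply: eq_bigr => l _; ring.
rewrite ipC !E; under eq_bigr => a _ do rewrite exchange_big.
rewrite exchange_big /=; apply: eq_bigr => j _.
under eq_bigr => a _ do rewrite exchange_big.
rewrite exchange_big /=; apply: eq_bigr => l _.
apply: eq_bigr => a _; apply: eq_bigr => b _.
by rewrite (rc_anti1 W a) (rc_anti2 W j); ring.
Qed.

Lemma lw_trmx W phi : curvop W -> phi^T = phi -> (lw W phi)^T = lw W phi.
Proof.
move=> cW ps; apply/matrixP => a b; rewrite !mxE exchange_big.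
apply: eq_bigr => j _; apply: eq_bigr => l _.
by rewrite (rc_sym b l a j cW) -{1}ps mxE.
Qed.

Lemma lw1 W : ricci W = 0 -> lw W 1%:M = 0.
Proof.
move=> W0; apply/matrixP => a b; rewrite !mxE.
have /matrixP/(_ b a) := W0; rewrite ricci_rc mxE => W0ba.
rewrite -[RHS]W0ba; apply: eq_bigr => j _.
rewrite -(sum_delta (fun l => rc W a j b l) j); apply: eq_bigr => l _.
by rewrite mxE eq_sym.
Qed.

Lemma lw_bounded W : exists2 K, 0 <= K & forall phi, `|ip phi (lw W phi)| <= K * ip phi phi.
Proof.
exists (\sum_a \sum_b \sum_j \sum_l `|rc W a j b l|).
  by do 4 (apply: sumr_ge0 => ? _).
move=> phi; rewrite mulr_suml; apply: le_trans (ler_norm_sum _ _ _) _.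
apply: ler_sum => a _; rewrite mulr_suml; apply: le_trans (ler_norm_sum _ _ _) _.
apply: ler_sum => b _; rewrite [lw _ _ _ _]mxE mulr_suml mulr_sumr.
apply: le_trans (ler_norm_sum _ _ _) _.
apply: ler_sum => j _; rewrite mulr_suml mulr_sumr; apply: le_trans (ler_norm_sum _ _ _) _.
apply: ler_sum => l _; rewrite mulrCA normrM ler_wpM2l //.
have := ip_entry phi a b; have := ip_entry phi j l.
by move=> h1 h2; rewrite ler_norml; apply/andP; split; nra.
Qed.

Lemma lw_dg w phi a b : symw w -> w a a = 0 ->
  lw (dg w) phi a b = (a == b)%:R * \sum_j w a j * phi j j - w a b * phi b a.
Proof.
move=> ws w0; rewrite mxE.
transitivity (\sum_j ((a == b)%:R * (w a j * phi j j) - w a j * phi j a * (j == b)%:R)).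
  apply: eq_bigr => j _; under eq_bigr => l _ do rewrite rc_dg //.
  transitivity (\sum_l ((w a j * (a == b)%:R * phi j l) * (l == j)%:R
      - (w a j * (j == b)%:R * phi j l) * (l == a)%:R)).
    by apply: eq_bigr => l _; rewrite (eq_sym j l) (eq_sym a l); ring.
  by rewrite sumrB !sum_delta; ring.
by rewrite sumrB -mulr_sumr (sum_delta (fun j => w a j * phi j a)).
Qed.

Hypothesis n_ge4 : (4 <= n)%N.

Lemma ex_notin (s : seq 'I_n) : (size s < n)%N -> exists k, k \notin s.
Proof.
move=> sn; apply: contrapT => H; move: sn; rewrite ltnNge => /negP; apply.
rewrite -{1}(card_ord n) cardE; apply: uniq_leq_size; first exact: enum_uniq.
by move=> k _; apply: contrapT => /negP ks; apply: H; exists k.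
Qed.

(** Cycle operators suffice as tests: an off-diagonal entry isolates [phi b a], a diagonal one the
    difference [phi j j - phi l l]. Four distinct indices are needed to close the cycle. *)
Lemma lw_kernel phi : (forall W, curvop W -> ricci W = 0 -> lw W phi = 0) ->
  exists c, phi = c%:M.
Proof.
move=> H.
have Hc i j k l a b : uniq [:: i; j; k; l] -> lw (dg (cycw R i j k l)) phi a b = 0.
  move=> U; rewrite H ?mxE //; first by apply: curvop_dg; exact: cycw_sym.
  apply: ricci_dg; [exact: cycw_sym | by move=> c; exact: cycw_diag | exact: cycw_row].
have n3 : (3 < n)%N by [].
have off a b : a != b -> phi b a = 0.
  move=> ab; have [|k] := @ex_notin [:: a; b]; first by rewrite /= ltnW.
  rewrite !inE negb_or => /andP[ka kb].
  have [|l] := @ex_notin [:: a; b; k]; first by [].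
  rewrite !inE !negb_or => /and3P[la lb lk].
  have U : uniq [:: a; b; k; l].
    by rewrite /= !inE !negb_or ab (eq_sym a k) ka (eq_sym a l) la
      (eq_sym b k) kb (eq_sym b l) lb eq_sym lk.
  have := Hc _ _ _ _ a b U; rewrite lw_dg; [|exact: cycw_sym | exact: cycw_diag].
  by rewrite (negbTE ab) cycw_ij //=; lra.
have dia j l : phi j j = phi l l.
  have [->//|jl] := eqVneq j l.
  have [|i] := @ex_notin [:: j; l]; first by rewrite /= ltnW.
  rewrite !inE negb_or => /andP[ij il].
  have [|k] := @ex_notin [:: i; j; l]; first by [].
  rewrite !inE !negb_or => /and3P[ki kj kl].
  have U : uniq [:: i; j; k; l].
    by rewrite /= !inE !negb_or ij il (eq_sym i k) ki (eq_sym j k) kj jl kl.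
  have := Hc _ _ _ _ i i U; rewrite lw_dg; [|exact: cycw_sym | exact: cycw_diag].
  rewrite eqxx mul1r cycw_diag // mul0r subr0.
  have ik : (i == k) = false by rewrite eq_sym (negbTE ki).
  rewrite (eq_bigr (fun b => phi b b * (b == j)%:R - phi b b * (b == l)%:R)).
    by rewrite sumrB !sum_delta; lra.
  by move=> b _; rewrite /cycw eqxx (negbTE ij) (negbTE il) ik /=; ring.
have i0 : 'I_n by exact: (Ordinal n3).
exists (phi i0 i0); apply/matrixP => a b; rewrite mxE.
by have [->|ab] := eqVneq a b; rewrite ?mulr1n ?mulr0n; [exact: dia | rewrite off // eq_sym].
Qed.

End RicciAction.

(** * Duality between the curvature cone and a cone of symmetric matrices *)

Section Cone.
Variables (R : realType) (n : nat).
Hypothesis n_ge4 : (4 <= n)%N.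
Variable C : set 'M[R]_(dimL2 n).
Hypothesis hC : curvature_cone C.
Implicit Types (A B W X : 'M[R]_(dimL2 n)) (phi psi r : 'M[R]_n).

Lemma cone_ball : exists2 e : R, 0 < e & forall B, curvop B -> `|1%:M - B| < e -> C B.
Proof. by have /curv_interiorE[] := cone_id hC. Qed.

Lemma curvop1 : curvop (1%:M : 'M[R]_(dimL2 n)).
Proof. by have /curv_interiorE[] := cone_id hC. Qed.

Lemma cone1 : C 1%:M.
Proof. by have [e e0 H] := cone_ball; apply: H; [exact: curvop1 | rewrite subrr normr0]. Qed.

Lemma cone0 : C 0.
Proof. by rewrite -(scale0r 1%:M); apply: (cone_scale hC) => //; exact: cone1. Qed.

Lemma coneD A B : C A -> C B -> C (A + B).
Proof.
move=> CA CB.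
have h0 : (0 : R) <= 2^-1 by lra.
have h1 : (2^-1 : R) <= 1 by lra.
have /set_mem := cone_convex hC (Itv01 h0 h1) (mem_set CA) (mem_set CB).
move=> /(cone_scale hC (a := 2)) => /(_ ltac:(lra)).
suff -> : A + B = 2 *: (2^-1 *: A + (1 - 2^-1) *: B) by [].
by apply/matrixP => i j; rewrite !mxE; field.
Qed.

Lemma ricci1 : ricci 1%:M = (n%:R - 1) *: (1%:M : 'M[R]_n).
Proof.
have E : 2 *: ricci 1%:M = (2 * (n%:R - 1)) *: 1%:M :> 'M[R]_n.
  by rewrite -ricciZ -kn1 ricci_kn mxtrace1 -scalerDl; congr (_ *: _); ring.
have two : (2 : R) != 0 by rewrite pnatr_eq0.
by apply: (scalerI two); rewrite E scalerA.
Qed.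

(* The dual cone of [C], pulled back along the Ricci contraction. *)
Definition rdual phi : Prop := phi^T = phi /\ forall A, C A -> 0 <= ip phi (ricci A).

Variable F : 'M[R]_(dimL2 n).
Hypotheses (CF : C F) (F_neq0 : F <> 0) (F_flat : ricci F = 0).

(** Bipolar theorem. If [A] were outside [C], the separating operator [B] would have no Weyl part
    because of [F], and [schouten (ricci B)] would be an element of [rdual] negative on
    [ricci A]. *)
Lemma rdual_dual A : curvop A -> (forall psi, rdual psi -> 0 <= ip psi (ricci A)) -> C A.
Proof.
move=> cA H; apply: contrapT => nCA.
have [P CP [pos neg]] := cone_separation (cone_closed hC) cone0 coneD
  (fun a X a0 => cone_scale hC a0) nCA.
set B := P - A in pos neg.
have cB : curvop B by apply: curvopB => //; exact: (cone_sub hC).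
have [Bs _] := cB.
have W0 : weyl B = 0.
  apply: (weyl_dual_eq0 n_ge4 cB (cone_sub hC CF)) => // g og.
  by rewrite tr_ip //; apply: pos; exact: (cone_act hC).
have BE X : ip B X = ip (schouten (ricci B)) (ricci X).
  rewrite -tr_ip // -tr_lift; last exact: ricci_sym.
  by move/eqP: W0; rewrite /weyl subr_eq0 => /eqP <-.
have : rdual (schouten (ricci B)).
  split; first exact/schouten_sym/ricci_sym.
  by move=> X CX; rewrite -BE; exact: pos.
by move/H; rewrite -BE leNgt neg.
Qed.

(** As the identity is interior, adding or subtracting small lifts of elementary symmetric matrices
    keeps it in [C]; pairing [phi] with the results bounds its entries by its trace. Hence the slice
    of trace 1 is compact. *)
Lemma rdual_bound : exists2 K, 0 < K & forall phi, rdual phi ->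
  forall i j, `|phi i j| <= K * \tr phi.
Proof.
have n4 := nR_ge4 R n_ge4; have [e e0 H] := cone_ball.
pose E i j : 'M[R]_n := delta_mx i j + delta_mx j i.
pose N := \sum_i \sum_j `|kn_lift (E i j)|.
have N0 : 0 <= N by apply: sumr_ge0 => ? _; apply: sumr_ge0.
have NE i j : `|kn_lift (E i j)| <= N.
  rewrite /N (bigD1 i) //= (bigD1 j) //= -addrA lerDl.
  by apply: addr_ge0; apply: sumr_ge0 => // ? _; apply: sumr_ge0.
(* This gives [d * N < e], one step size for all [i] and [j]. *)
pose d := e / (N + 1).
have d0 : 0 < d by rewrite divr_gt0 //; lra.
have Es i j : (E i j)^T = E i j by rewrite /E linearD /= !trmx_delta addrC.
have Cd i j (s : R) : `|s| = 1 -> C (1%:M - (s * d) *: kn_lift (E i j)).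
  move=> s1; apply: H.
    by apply: curvopB; [exact: curvop1 | apply/curvopZ/curvop_lift/Es].
  rewrite subKr normrZ normrM s1 mul1r (gtr0_norm d0).
  apply: (@le_lt_trans _ _ (d * N)); first by rewrite ler_wpM2l // ltW.
  by rewrite /d -mulrA gtr_pMr // mulrC ltr_pdivrMr; lra.
exists ((n%:R - 1) / (2 * d)); first by rewrite divr_gt0 //; lra.
move=> phi [ps pC] i j.
have ipE : ip phi (E i j) = 2 * phi i j.
  have D a b : ip phi (delta_mx a b) = phi a b.
    rewrite /ip (bigD1 a) //= [X in _ + X]big1 ?addr0; last first.
      by move=> i' /negbTE ia; apply: big1 => j' _; rewrite mxE ia mulr0.
    rewrite (bigD1 b) //= big1 ?addr0; first by rewrite mxE !eqxx mulr1.
    by move=> j' /negbTE jb; rewrite mxE jb andbF mulr0.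
  by rewrite ipDr !D -[in phi j i]ps mxE; ring.
have B (s : R) : `|s| = 1 -> s * (2 * d) * phi i j <= (n%:R - 1) * \tr phi.
  move=> s1; have := pC _ (Cd i j s s1).
  rewrite ricciB ricci1 ricciZ ricci_lift // ipBr !ipZr ipE [ip phi _]ipC ip_scalar.
  by lra.
have := B 1 (normr1 _); have := B (-1) (normrN1 _).
have d2 : 0 < 2 * d by lra.
move=> b1 b2; rewrite mulrAC ler_norml -mulNr ler_pdivrMr // ler_pdivlMr //.
by apply/andP; split; nra.
Qed.

Lemma rdual_tr_ge0 phi : rdual phi -> 0 <= \tr phi.
Proof.
move=> pD; have [K K0 H] := rdual_bound.
have i0 : 'I_n by apply: (@Ordinal _ 0); exact: leq_trans n_ge4.
have := le_trans (normr_ge0 _) (H _ pD i0 i0).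
by rewrite pmulr_rge0.
Qed.

Lemma rdual_tr_eq0 phi : rdual phi -> \tr phi = 0 -> phi = 0.
Proof.
move=> pD t0; have [K K0 H] := rdual_bound.
apply/matrixP => i j; rewrite mxE; apply/eqP.
by have := H _ pD i j; rewrite t0 mulr0 normr_le0.
Qed.

Lemma rdualZ a phi : 0 <= a -> rdual phi -> rdual (a *: phi).
Proof.
move=> a0 [ps pC]; split; first by rewrite linearZ /= ps.
by move=> A CA; rewrite ipZl mulr_ge0 // pC.
Qed.

Lemma rdualD phi psi : rdual phi -> rdual psi -> rdual (phi + psi).
Proof.
move=> [ps pC] [qs qC]; split; first by rewrite linearD /= ps qs.
by move=> A CA; rewrite ipDl addr_ge0 ?pC ?qC.
Qed.

Definition rdual1 : set 'M[R]_n := [set phi | rdual phi /\ \tr phi = 1].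

Lemma rdual1_compact : compact rdual1.
Proof.
have [K K0 H] := rdual_bound.
apply: (@mx_bounded_closed_compact _ _ _ _ K).
  by move=> phi [pD t1] i j; have := H _ pD i j; rewrite t1 mulr1.
have -> : rdual1 = (\bigcap_(ij in setT) [set phi : 'M[R]_n |
      0 <= phi ij.1 ij.2 - phi ij.2 ij.1])
    `&` (\bigcap_(A in C) [set phi | 0 <= ip phi (ricci A)])
    `&` [set phi | \tr phi = 1].
  apply/seteqP; split => [phi [[ps pC] t1]|phi [[ps pC] t1]].
    split; [split | exact: t1]; last by move=> A CA; exact: pC.
    by move=> [i j] _ /=; rewrite -{1}ps mxE subrr.
  split=> //; split=> //; apply/matrixP => i j; rewrite mxE; apply/eqP; rewrite eq_le.
  by have := ps (i, j) I; have := ps (j, i) I; rewrite /= !subr_ge0 => -> ->.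
apply: closedI; first apply: closedI.
- apply: closed_bigI => -[i j] _.
  by apply: closed_halfspace => a u v; rewrite !mxE /=; ring.
- apply: closed_bigI => A _; apply: closed_halfspace => a u v; exact: ip_linear.
apply: (@closed_comp _ _ (@mxtrace R n) [set x | x = 1]).
  move=> x _; apply: (linear_mx_continuous (f := @mxtrace R n)) => a u v.
  by rewrite linearP.
exact: closed_eq.
Qed.

(** * Ricci flow invariance and the maximum argument *)

Hypothesis hinv : ricci_flow_invariant C.

(* Since [A + s W] lies on the boundary for every [s], the invariance forces
   the coefficient of [s] in [Ric (Q (A + s W))] to be annihilated by [phi]. *)
Lemma boundary_lw phi A W : rdual phi -> 0 < \tr phi -> C A -> ip phi (ricci A) = 0 ->
  curvop W -> ricci W = 0 -> ip phi (lw W (ricci A)) = 0.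
Proof.
move=> [ps pC] t0 CA A0 cW W0; have n4 := nR_ge4 R n_ge4.
pose p := ip phi (lw A (ricci A)); set q := LHS.
have line s : 0 <= p + s * q.
  pose X := s *: W + A.
  (* Elements of [rdual] only see the Ricci tensor, so [s *: W] is in [C] whatever the sign of
     [s]. *)
  have CX : C X.
    apply: coneD => //; apply: rdual_dual; first exact: curvopZ.
    move=> psi _; rewrite ricciZ W0 scaler0 [ip _ _]big1 // => i _; rewrite big1 // => j _.
    by rewrite [fun_of_matrix 0 _ _]mxE mulr0.
  have rX : ricci X = ricci A by rewrite /X ricci_linear W0 scaler0 add0r.
  (* The pairing with [phi] is zero at [X] and positive at the identity, so subtracting any positive
     multiple of the identity leaves [C]. *)
  have bX : curv_boundary C X.
    split; first exact: subset_closure.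
    move=> /curv_interiorE[cX [e e0 H]].
    pose d := e / (2 * (1 + `|1%:M : 'M[R]_(dimL2 n)|)).
    have N0 : 0 <= `|1%:M : 'M[R]_(dimL2 n)| by [].
    have d0 : 0 < d by rewrite divr_gt0 //; lra.
    have : C (X - d *: 1%:M).
      apply: H; first by apply: curvopB => //; apply/curvopZ/curvop1.
      rewrite subKr normrZ (gtr0_norm d0) /d -mulrA gtr_pMr // mulrC ltr_pdivrMr; lra.
    move/pC; rewrite ricciB ricciZ ricci1 rX ipBr A0 !ipZr ipC ip_scalar.
    have : 0 < d * ((n%:R - 1) * \tr phi) by rewrite !mulr_gt0 //; lra.
    by lra.
  have := hinv bX.
  (* A closed half-space that contains the tangent cone at [X]. *)
  pose Hs := [set L | 0 <= ip phi (ricci L)].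
  have Hcl : closed Hs.
    by apply: closed_halfspace => a u v; rewrite ricci_linear ipDr ipZr.
  rewrite /tangent_cone => TX.
  have : Hs (Qfield X).
    have -> : Hs = closure Hs by apply/closure_id.
    apply: closureS TX => L [s' s0 CL]; rewrite /Hs /=.
    have := pC _ CL; rewrite ricciD ricciZ rX ipDr A0 add0r ipZr.
    by rewrite pmulr_rge0.
  rewrite /Hs /= ricci_Qfield; last exact: (cone_sub hC).
  by rewrite rX /X lw_linearop ipDr ipZr addrC.
apply/eqP; apply: contrapT => /negP q0.
(* At this [s] the affine function would equal -1. *)
have := line (- (p + 1) / q); rewrite divfK //; lra.
Qed.

(* First-order condition at a maximiser of [|(1 + c L) phi|^2], [L = lw W]. *)
Lemma maximiser_lw c W p : curvop W -> ricci W = 0 -> rdual1 p ->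
  (forall psi, rdual1 psi ->
    ip (psi + c *: lw W psi) (psi + c *: lw W psi) 
      <= ip (p + c *: lw W p) (p + c *: lw W p)) ->
  ip p (lw W p) + 2 * c * ip (lw W p) (lw W p)
   + c ^+ 2 * ip (lw W p) (lw W (lw W p)) = 0.
Proof.
move=> cW W0 [pD p1] pmax; have [ps pC] := pD.
pose L := lw W; pose T phi := phi + c *: L phi.
have LD u v : L (u + v) = L u + L v by rewrite -[u]scale1r /L lw_linear !scale1r.
have L0 : L 0 = 0.
  by have := lw_linear W (-1) 0 0; rewrite scaler0 addr0 scaleN1r addNr.
have LZ a u : L (a *: u) = a *: L u.
  by have := lw_linear W a u 0; rewrite addr0 -/(L 0) L0 addr0.
have LA u v : ip (L u) v = ip u (L v) by exact: lw_self_adjoint.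
have TD u v : T (u + v) = T u + T v.
  by rewrite /T LD scalerDr addrACA.
have TZ a u : T (a *: u) = a *: T u.
  by rewrite /T LZ scalerDr !scalerA mulrC.
have TA u v : ip (T u) v = ip u (T v) by rewrite /T ipDl ipDr ipZl ipZr LA.
have Ts u : u^T = u -> (T u)^T = T u.
  by move=> us; rewrite /T linearD /= linearZ /= us lw_trmx.
(* Since [T] is self-adjoint, [q] is half the gradient at [p] of the maximised form. *)
pose q := T (T p); pose k := ip q p.
have qmax psi : rdual1 psi -> ip q psi <= k.
  move=> [sD s1].
  suff : 0 <= - ip (T p) (T (psi - p)).
    by rewrite -TA -/q ipBr /k; lra.
  apply: (@quad_ge0 _ _ (- ip (T (psi - p)) (T (psi - p)))) => t t0 t1.
  have : rdual1 (p + t *: (psi - p)).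
    split; last by rewrite linearD /= linearZ /= linearB /= s1 p1 subrr mulr0 addr0.
    rewrite scalerBr addrCA -[X in _ + (X - _)]scale1r -scalerBl.
    by apply: rdualD; apply: rdualZ => //; lra.
  move/pmax; rewrite -!/(T _) TD TZ.
  by rewrite ip_sqrD; lra.
(* On [psi] of trace 1 this matrix measures the gap [k - ip q psi], nonnegative and zero at [p]; its
   lift is therefore in [C] and supported by [p]. *)
pose r := k%:M - q.
have rs : r^T = r by rewrite /r linearB /= tr_scalar_mx !Ts.
have rpsi psi : ip psi r = k * \tr psi - ip q psi.
  by rewrite /r ipBr ipC ip_scalar ipC.
have Cr : C (kn_lift r).
  apply: rdual_dual; first exact: curvop_lift.
  move=> psi sD; rewrite ricci_lift // rpsi.
  have [t0|t0] := eqVneq (\tr psi) 0.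
    rewrite (rdual_tr_eq0 sD t0) raddf0 mulr0 sub0r [ip _ _]big1 ?oppr0 // => i _.
    by rewrite big1 // => j _; rewrite [fun_of_matrix 0 _ _]mxE mulr0.
  have tp : 0 < \tr psi by rewrite lt_neqAle eq_sym t0 rdual_tr_ge0.
  have : rdual1 ((\tr psi)^-1 *: psi).
    split; first by apply: rdualZ => //; rewrite invr_ge0 ltW.
    by rewrite linearZ /= mulVf.
  by move/qmax; rewrite ipZr mulrC ler_pdivrMr // subr_ge0.
have := @boundary_lw p (kn_lift r) W pD; rewrite p1 ricci_lift // rpsi p1 mulr1 subrr.
move=> /(_ ltr01 Cr erefl cW W0).
have -> : lw W r = - L q.
  rewrite /r -/(L _) -scaleN1r LD LZ scaleN1r -scalemx1 LZ /L lw1 // scaler0 sub0r.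
  by [].
have -> : q = (p + (2 * c) *: L p) + c ^+ 2 *: L (L p).
  by rewrite /q {1}/T [L (T p)]LD LZ /T; apply/matrixP => i j; rewrite !mxE; ring.
rewrite -scaleN1r ipZr -LA 2!ipDr !ipZr (ipC (L p) p) -/L.
by lra.
Qed.

Lemma rdual1_scalar a : rdual1 a -> (forall psi, rdual1 psi -> ip psi psi <= ip a a) ->
  exists c, a = c%:M.
Proof.
move=> aD amax; apply: (lw_kernel n_ge4) => W cW W0.
have [K K0 HK] := lw_bounded W.
(* Only [0 < c] and [c * K <= 1] matter: the term of order three is then dominated by that of order
   two. *)
pose c := (K + 1)^-1.
have c0 : 0 < c by rewrite invr_gt0; lra.
have cK : c * K <= 1 by rewrite mulrC ler_pdivrMr; lra.
pose f phi := ip (phi + c *: lw W phi) (phi + c *: lw W phi).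
have fE phi : f phi = ip phi phi + 2 * c * ip phi (lw W phi) + c ^+ 2 * ip (lw W phi) (lw W phi).
  by rewrite /f ip_sqrD.
have fc : continuous f.
  have -> : f = fun phi => ip (phi + c *: lw W phi - 0) (phi + c *: lw W phi - 0).
    by apply: funext => phi; rewrite subr0.
  apply: (@ip_sqr_continuous R n (fun phi => phi + c *: lw W phi)) => b u v.
  by rewrite lw_linear !scalerDr !scalerA [c * b]mulrC addrACA.
have S0 : rdual1 !=set0 by exists a.
have [p /set_mem pD pmax] := compact_EVT_max S0 rdual1_compact (continuous_subspaceT fc).
(* For [c = 0] the maximised function is the squared norm itself. *)
have E0 := @maximiser_lw 0 W a cW W0 aD.
have {}E0 : ip a (lw W a) = 0.
  suff H psi : rdual1 psi -> ip (psi + 0 *: lw W psi) (psi + 0 *: lw W psi)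
     <= ip (a + 0 *: lw W a) (a + 0 *: lw W a) by have := E0 H; lra.
  by rewrite !scale0r !addr0; exact: amax.
have E1 : ip p (lw W p) + 2 * c * ip (lw W p) (lw W p)
   + c ^+ 2 * ip (lw W p) (lw W (lw W p)) = 0.
  apply: maximiser_lw => // psi sD; apply: pmax; exact: mem_set.
have Z := HK (lw W p); move: Z; rewrite ler_norml => /andP[Z _].
have y0 := ip_ge0 (lw W p).
have fp : f p <= ip p p.
  rewrite fE; move: E1 Z y0.
  move: (ip p (lw W p)) (ip (lw W p) (lw W (lw W p))) (ip (lw W p) (lw W p)).
  move=> x z y E1 Z y0.
  have -> : x = - (2 * c * y) - c ^+ 2 * z by lra.
  have h1 : - (c * K * y) <= c * z by nra.
  have h2 : c * K * y <= y by nra.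
  (* Eliminating [x], [f p] is [ip p p] minus this quantity, which is nonnegative because
     [c * z >= - y]. *)
  have h3 : 0 <= c ^+ 2 * (3 * y + 2 * (c * z)) by rewrite mulr_ge0 ?sqr_ge0 //; lra.
  by lra.
have := pmax a (mem_set aD); rewrite [f a]fE E0 mulr0 addr0 => fa.
have pa := amax _ pD; have := ip_ge0 (lw W a).
have c2 : 0 < c ^+ 2 by rewrite exprn_gt0.
(* The chain [f a <= f p <= ip p p <= ip a a] closes up, where [f a] exceeds [ip a a] by
   [c ^+ 2 * ip (lw W a) (lw W a)]. *)
move=> y; apply: ip_eq0; nra.
Qed.

Lemma cone_classification : C = @curvop R n \/ C = @cone_scal R n.
Proof.
have n4 := nR_ge4 R n_ge4.
have [S0|S0] := pselect (rdual1 !=set0); last first.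
  (* An empty slice means that [rdual] is reduced to 0, so it imposes no constraint. *)
  left; apply/seteqP; split; first exact: (cone_sub hC).
  move=> A cA; apply: rdual_dual => // psi sD.
  suff -> : psi = 0.
    by rewrite [ip _ _]big1 // => i _; rewrite big1 // => j _; rewrite mxE mul0r.
  apply: (rdual_tr_eq0 sD); apply: contrapT => /eqP t0; apply: S0.
  exists ((\tr psi)^-1 *: psi); split; last by rewrite linearZ /= mulVf.
  by apply: rdualZ => //; rewrite invr_ge0 rdual_tr_ge0.
right.
have fc : continuous (fun phi : 'M[R]_n => ip phi phi).
  have -> : (fun phi : 'M[R]_n => ip phi phi) = fun phi => ip (phi - 0) (phi - 0).
    by apply: funext => phi; rewrite subr0.
  exact: (@ip_sqr_continuous R n id).
have [a /set_mem aD amax] := compact_EVT_max S0 rdual1_compact (continuous_subspaceT fc).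
have {}amax psi : rdual1 psi -> ip psi psi <= ip a a by move=> sD; apply: amax; exact: mem_set.
have [c ac] := rdual1_scalar aD amax.
have [aD' a1] := aD.
have nc : n%:R * c = 1 by have := a1; rewrite ac mxtrace_scalar mulr_natl.
have c0 : 0 < c by nra.
(* As [a] is scalar, [ip psi a = ip a a], so the squared distance from [psi] to [a] is
   [ip psi psi - ip a a <= 0]. *)
have uniq_a psi : rdual1 psi -> psi = a.
  move=> sD; have := amax _ sD; case: (sD) => _ s1.
  have sa : ip psi a = c by rewrite ipC {1}ac ip_scalar s1 mulr1.
  have aa : ip a a = c by rewrite {1}ac ip_scalar a1 mulr1.
  move=> le; apply/eqP; rewrite -subr_eq0; apply/eqP/ip_eq0/eqP.
  rewrite eq_le ip_ge0 andbT ipBl !ipBr (ipC a psi) sa aa; lra.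
have dualE psi : rdual psi -> psi = \tr psi *: a.
  move=> sD; have [t0|t0] := eqVneq (\tr psi) 0.
    by rewrite t0 scale0r; exact: rdual_tr_eq0.
  rewrite -(uniq_a ((\tr psi)^-1 *: psi)); first by rewrite scalerA mulfV ?scale1r.
  split; last by rewrite linearZ /= mulVf.
  by apply: rdualZ => //; rewrite invr_ge0 rdual_tr_ge0.
apply/seteqP; split => [A CA|A [cA tA]].
  split; first exact: (cone_sub hC).
  have [_ /(_ _ CA)] := aD'; rewrite ac ip_scalar tr_ricci pmulr_rge0 //.
  by rewrite pmulr_rge0.
apply: rdual_dual => // psi sD; rewrite (dualE _ sD) ipZl ac ip_scalar tr_ricci.
by rewrite !mulr_ge0 ?rdual_tr_ge0 // ltW.
Qed.

End Cone.

Theorem theorem0p1 (R : realType) (n : nat) (hn : (4 <= n)%N)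
    (C : set 'M[R]_(dimL2 n)) (hC : curvature_cone C)
    (hinv : ricci_flow_invariant C)
    (hflat : exists A : 'M[R]_(dimL2 n), [/\ C A, A <> 0 & ricci A = 0]) :
  C = @curvop R n \/ C = @cone_scal R n.
Proof. by have [F [CF F0 Ff]] := hflat; exact: (cone_classification hn hC CF F0 Ff hinv). Qed.
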